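(* Let $F$ be a tract and $E$ a finite nonempty set. (i) If $\mathcal M$ is a strong $F$-matroid on $E$, then both $\mathcal V(\mathcal M)$ and $\mathcal V^*(\mathcal M)$ are $F$-vector sets. (ii) If $\mathcal W\subseteq F^E$ is an $F$-vector set, then there is a strong $F$-matroid $\mathcal M$ on $E$ with $\mathcal W=\mathcal V^*(\mathcal M)$, and moreover $\mathcal C^*(\mathcal M)=\mathrm{Minsupp}(\mathcal V^*(\mathcal M)-\{\mathbf 0\})$ and $\mathcal C(\mathcal M)=\mathrm{Minsupp}((\mathcal V^*(\mathcal M))^\perp-\{\mathbf 0\})$.
   Context: A tract is a multiplicative group $G$ together with a subset $N_G$ of the group semiring $\mathbb N[G]$ such that: the zero element of $\mathbb N[G]$ lies in $N_G$; $1\notin N_G$; there is a unique $\eta\in G$ with $1+\eta\in N_G$; and $N_G$ is closed under multiplication by elements of $G$. Write $F=G\cup\{0\}$ (with $0\cdot x=0$), $-g:=\eta g$, $-0:=0$, and for $a_1,\dots,a_k\in F$ let $\boxplus_{j=1}^k a_j:=\{b\in F:\ -b+\sum_j a_j\in N_G\}$ (zero terms are dropped from formal sums; the empty hypersum is $\{0\}$). The tract carries a conjugation, an automorphism $x\mapsto x^c$ with $(x^c)^c=x$ (the identity unless stated otherwise). For a finite set $E$, $\mathbf 0\in F^E$ is the zero vector, $F$ acts on $F^E$ componentwise, and for $X_1,\dots,X_k\in F^E$, $\boxplus_j X_j:=\{Z\in F^E: Z(e)\in\boxplus_j X_j(e)\text{ for all }e\}$. The support of $X$ is $\underline X=\{e: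 X(e)\neq 0\}$ and its zero set is $X^0=E\setminus\underline X$. For $S\subseteq F^E$, $\mathrm{Minsupp}(S)$ is the set of elements of $S$ with inclusion-minimal support. The inner product is $X\cdot Y=\sum_{e\in E}X(e)Y(e)^c\in\mathbb N[G]$; $X\perp Y$ means $X\cdot Y\in N_G$; $S^\perp=\{X\in F^E: X\perp Y\ \forall Y\in S\}$. Strong $F$-matroids: $\mathcal C\subseteq F^E$ is the set of $F$-circuits of a strong $F$-matroid $\mathcal M$ on $E$ if (1) $\mathbf 0\notin\mathcal C$; (2) $\alpha X\in\mathcal C$ for $X\in\mathcal C$, $\alpha\in G$; (3) if $X,Y\in\mathcal C$ and $\underline X\subseteq\underline Y$ then $X=\alpha Y$ for some $\alpha\in G$; (4) (strong modular elimination) if $\{X_1,\dots,X_k,X\}\subseteq\mathcal C$ is a modular family of size $k+1$ with $\underline X\not\subseteq\bigcup_j\underline{X_j}$, and for each $j$, $e_j\in(\underline X\cap\underline{X_j})\setminus\bigcup_{l\ne j}\underline{X_l}$ satisfies $X(e_j)=-X_j(e_j)$, then there is $Z\in\mathcal C$ with $Z(e_j)=0$ for all $j$ and $Z\in X\boxplus X_1\boxplus\cdots\boxplus X_k$. Here $S\subseteq\mathcal C$ is a modular family if, in the lattice of all unions of supports of elements of $\mathcal C$ (ordered by inclusion), the supports of the elements of $S$ are atoms whose join has height $|S|$. It is known (Baker–Bowler) that $\mathcal C^*(\mathcal M):=\mathrm{Minsupp}(\mathcal C(\mathcal M)^\perp-\{\mathbf 0\})$ is again the $F$-circuit set of a strong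 $F$-matroid; its elements are the $F$-cocircuits of $\mathcal M$. The $F$-covectors of $\mathcal M$ are $\mathcal V^*(\mathcal M):=\mathcal C(\mathcal M)^\perp$ and the $F$-vectors are $\mathcal V(\mathcal M):=\mathcal C^*(\mathcal M)^\perp$. $F$-vector sets: for $\mathcal W\subseteq F^E$, a support basis of $\mathcal W$ is an inclusion-minimal $B\subseteq E$ with $B\cap\underline X\neq\emptyset$ for all $X\in\mathcal W-\{\mathbf 0\}$. For a support basis $B$, a nearly reduced row-echelon form for $\mathcal W$ with respect to $B$ is a subset $\{S_j: j\in B\}\subseteq\mathcal W$ with $\underline{S_j}\cap B=\{j\}$ for each $j$. $X$ is a linear combination of $Y_1,\dots,Y_k$ if $X\in\boxplus_j\alpha_jY_j$ for some $\alpha_j\in F$. $\mathcal W$ is an $F$-vector set if $\mathcal W$ equals the set of all $X\in F^E$ such that for every support basis $B$ of $\mathcal W$ and every nearly reduced row-echelon form $\{S_j:j\in B\}$ for $\mathcal W$ with respect to $B$, $X$ is a linear combination of $\{S_j:j\in B\}$.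
   Formalization: The group G of a tract is assumed abelian, as in Baker–Bowler; for a noncommutative G part (ii) fails, e.g. over a skew field the F-vector set {(x, xa)} with a non-central is not the covector set of any strong F-matroid. *)

(* Defs.v *)
From HB Require Import structures.
From mathcomp Require Import all_boot.
From mathcomp Require Import finmap multiset.
From mathcomp Require Import boolp classical_sets.

Set Implicit Arguments.
Unset Strict Implicit.
Unset Printing Implicit Defensive.

Local Open Scope mset_scope.
Local Open Scope classical_set_scope.

(* Elements of the group semiring N[G] are finite multisets on G: seq_mset s is
   the formal sum of the list s, and mset0 is its zero. *)

Definition mset_map (G : choiceType) (f : G -> G) (p : {mset G}) :
    {mset G} :=
  seq_mset [seq f h | h <- p].

(* [groupType] is not commutative, so commutativity is an axiom: without it the
   set C^perp below is not stable under scaling and duality fails. *)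
Record tract := Tract {
  tract_group :> groupType;
  tract_mulC : commutative (fun x y : tract_group => (x * y)%g);
  nullset : set {mset tract_group};
  eta : tract_group;
  nullset0 : nullset mset0;
  nullset1 : ~ nullset (seq_mset [:: 1%g]);
  nullset_eta : nullset (seq_mset [:: 1%g; eta]);
  nullset_eta_uniq : forall x, nullset (seq_mset [:: 1%g; x]) -> x = eta;
  nullsetM : forall g p, nullset p -> nullset (mset_map (fun h => g * h)%g p)
}.

Record conjugation (T : tract) := Conjugation {
  conj_fun :> T -> T;
  conjM : {morph conj_fun : x y / (x * y)%g};
  conjK : involutive conj_fun;
  conj_nullset : forall p, nullset p -> nullset (mset_map conj_fun p)
}.

(* F = G u {0}, with None as 0; formal sums drop None. *)
Notation ext T := (option (tract_group T)).

Section Scalars.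
Variable T : tract.

Definition fmul (a b : ext T) : ext T :=
  if a is Some x then if b is Some y then Some (x * y)%g else None else None.

Definition fopp (a : ext T) : ext T := omap (fun x => eta T * x)%g a.

Definition fconj (c : conjugation T) (a : ext T) : ext T := omap c a.

Definition fsum (s : seq (ext T)) : {mset T} := seq_mset (pmap id s).

Definition hypersum (s : seq (ext T)) : set (ext T) :=
  [set b | nullset (fsum (fopp b :: s))].

End Scalars.

Notation vec T E := {ffun E -> ext T}.

Section Vectors.
Variables (T : tract) (E : finType).
Implicit Types (X Y Z : vec T E) (S W : set (vec T E)).

Definition vzero : vec T E := [ffun=> None].

Definition vscale (a : ext T) X : vec T E := [ffun e => fmul a (X e)].

Definition vhypersum (s : seq (vec T E)) : set (vec T E) :=
  [set Z | forall e, hypersum [seq X e | X : vec T E <- s] (Z e)].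

Definition supp X : {set E} := [set e | X e != None]%SET.

Definition minsupp S : set (vec T E) :=
  [set X | S X /\ forall Y, S Y -> ~~ (supp Y \proper supp X)].

Definition inner (c : conjugation T) X Y : {mset T} :=
  fsum [seq fmul (X e) (fconj c (Y e)) | e : E].

Definition perp (c : conjugation T) S : set (vec T E) :=
  [set X | forall Y, S Y -> nullset (inner c X Y)].

End Vectors.

Arguments vzero {T E}.

Section Lattice.
Variables (E : finType) (L : {set {set E}}).

Definition is_chain (P : {set {set E}}) : bool :=
  [forall A in P, forall B in P, (A \subset B) || (B \subset A)].

(* The length of a chain is its cardinality minus one. *)
Definition height (U : {set E}) : nat :=
  \max_(P : {set {set E}} |
        (P \subset [set A in L | A \subset U]%SET) && is_chain P) #|P|.-1.

(* Atoms, for L with bottom element set0. *)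
Definition is_atom (A : {set E}) : bool :=
  [&& A \in L, A != finset.set0 &
      [forall B in L, (B \proper A) ==> (B == finset.set0)]].

End Lattice.

Section Matroids.
Variables (T : tract) (E : finType).
Implicit Types (X Y Z : vec T E) (C W : set (vec T E)).

Definition supports C : {set {set E}} :=
  [set A | `[< exists2 X, C X & supp X = A >]]%SET.

Definition support_lattice C : {set {set E}} :=
  [set finset.cover P | P in powerset (supports C)]%SET.

(* A finite set of vectors is given by a list without repetition. *)
Definition modular_family C (s : seq (vec T E)) : Prop :=
  [/\ uniq s,
      {in s, forall X, C X},
      {in s, forall X, is_atom (support_lattice C) (supp X)} &
      height (support_lattice C) (\bigcup_(X <- s) supp X)%SET = size s].

Definition strong_modular_elimination C : Prop :=
  forall (k : nat) (X : vec T E) (Xs : 'I_k -> vec T E) (e : 'I_k -> E),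
    modular_family C (X :: [seq Xs j | j : 'I_k]) ->
    ~~ (supp X \subset (\bigcup_j supp (Xs j))%SET) ->
    (forall j, e j \in
       (supp X :&: supp (Xs j) :\: \bigcup_(l | l != j) supp (Xs l))%SET) ->
    (forall j, X (e j) = fopp (Xs j (e j))) ->
    exists Z, [/\ C Z,
                  forall j, Z (e j) = None &
                  vhypersum (X :: [seq Xs j | j : 'I_k]) Z].

Record strong_matroid := StrongMatroid {
  circuits : set (vec T E);
  circuits_neq0 : ~ circuits vzero;
  circuitsZ : forall X (a : T), circuits X -> circuits (vscale (Some a) X);
  circuits_supp : forall X Y, circuits X -> circuits Y ->
    supp X \subset supp Y -> exists a : T, X = vscale (Some a) Y;
  circuits_elim : strong_modular_elimination circuits
}.

Variable c : conjugation T.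

Definition cocircuits (M : strong_matroid) : set (vec T E) :=
  minsupp (perp c (circuits M) `\ vzero).

Definition covectors (M : strong_matroid) : set (vec T E) :=
  perp c (circuits M).

Definition vectors (M : strong_matroid) : set (vec T E) :=
  perp c (cocircuits M).

End Matroids.

Section VectorSets.
Variables (T : tract) (E : finType).
Implicit Types (X : vec T E) (W : set (vec T E)).

Definition support_basis W (B : {set E}) : Prop :=
  minset (fun A : {set E} =>
    `[< forall X, W X -> X <> vzero -> (A :&: supp X != finset.set0)%SET >]) B.

(* Only the values S j with j \in B matter. *)
Definition nearly_rref W (B : {set E}) (S : E -> vec T E) : Prop :=
  {in B, forall j, W (S j) /\ (supp (S j) :&: B)%SET = [set j]%SET}.

Definition linear_combination (B : {set E}) (S : E -> vec T E) X : Prop :=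
  exists a : E -> ext T, vhypersum [seq vscale (a j) (S j) | j in B] X.

Definition vector_set W : Prop :=
  W = [set X | forall B, support_basis W B -> forall S, nearly_rref W B S ->
                 linear_combination B S X].

End VectorSets.

(* Main.v *)
(** Both directions rest on one computation. If [S_j] (for [j \in B]) is an
    echelon form, [e \notin B], and [Y_e] is supported on [e |: B] and
    orthogonal to all [S_j], then the coordinate [e] of "[X] is a linear
    combination of the [S_j]" says exactly that [X] is orthogonal to [Y_e].

    For a strong matroid, the [Y_e] are fundamental circuits of a basis [B], and
    the vectors [S_j] exist in [C^perp]: eliminating all but one element of
    [supp X :\: B] from a circuit [X] by fundamental circuits, in a single
    strong modular elimination, shows that [X] is orthogonal to the only
    candidate. Modularity of the families involved needs the underlying matroid,
    whose circuit elimination axiom follows from modular elimination of pairs.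

    Conversely, for a vector set [W], support bases satisfy basis exchange, the
    vectors of minimal support in [W^perp] are the multiples of the fundamental
    [Y_e], and a modular family [X, X_1, ..., X_k] sits over one support basis in
    which the [X_j] are fundamental circuits; the eliminated circuit is then also
    fundamental. *)

Require Import Defs.
From mathcomp Require Import boolp classical_sets finmap multiset all_boot.

Set Implicit Arguments.
Unset Strict Implicit.
Unset Printing Implicit Defensive.

(** * Arithmetic in a tract *)

Section Scalars.
Variables (T : tract) (c : conjugation T).
Implicit Types (a b d : ext T) (s t : seq (ext T)) (x y : T).

Local Notation null s := (nullset (fsum s)).

Definition fmulinv a : ext T := omap (fun x => x^-1)%g a.

Lemma fmulC : commutative (@fmul T).
Proof. by case=> [x|] [y|] //=; rewrite tract_mulC. Qed.

Lemma fmulA : associative (@fmul T).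
Proof. by case=> [x|] [y|] [z|] //=; rewrite mulgA. Qed.

Lemma fmul0 a : fmul a None = None. Proof. by case: a. Qed.

Lemma fmul1 a : fmul (Some 1%g) a = a.
Proof. by case: a => //= x; rewrite mul1g. Qed.

Lemma fmulV a : a != None -> fmul a (fmulinv a) = Some 1%g.
Proof. by case: a => //= x _; rewrite mulgV. Qed.

Lemma fmul_eq0 a b : (fmul a b == None) = (a == None) || (b == None).
Proof. by case: a b => [x|] [y|]. Qed.

Lemma foppE a : fopp a = fmul (Some (eta T)) a. Proof. by case: a. Qed.

Lemma fopp_eq0 a : (fopp a == None) = (a == None). Proof. by case: a. Qed.

Lemma fconj_eq0 a : (fconj c a == None) = (a == None). Proof. by case: a. Qed.

Lemma fconjK : involutive (fconj c).
Proof. by case=> //= x; rewrite conjK. Qed.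

Lemma fconjM a b : fconj c (fmul a b) = fmul (fconj c a) (fconj c b).
Proof. by case: a b => [x|] [y|] //=; rewrite conjM. Qed.

Lemma fopp_fmull a b : fmul (fopp a) b = fopp (fmul a b).
Proof. by rewrite !foppE fmulA. Qed.

Lemma fopp_fmulr a b : fmul a (fopp b) = fopp (fmul a b).
Proof. by rewrite fmulC fopp_fmull fmulC. Qed.

Lemma perm_fsum s t : perm_eq s t -> fsum s = fsum t.
Proof. by move=> p; apply/eq_seq_msetP/perm_pmap. Qed.

Lemma mset_map_fsum (f : T -> T) s :
  mset_map f (fsum s) = fsum [seq omap f a | a <- s].
Proof.
apply/eq_seq_msetP.
have -> : pmap id [seq omap f a | a <- s] = [seq f x | x <- pmap id s].
  by elim: s => //= -[x|] s /= ->.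
by apply: perm_map; apply: perm_eq_seq_mset.
Qed.

Lemma null_scale_sub x s : null s -> null [seq fmul (Some x) a | a <- s].
Proof.
move/(nullsetM x); rewrite mset_map_fsum.
by congr (nullset (fsum _)); apply: eq_map; case.
Qed.

Lemma null_scale b s : b != None -> null [seq fmul b a | a <- s] <-> null s.
Proof.
case: b => // x _; split; last exact: null_scale_sub.
move=> /(null_scale_sub x^-1%g); rewrite -map_comp.
congr (nullset (fsum _)); rewrite -[RHS]map_id; apply: eq_map.
by case=> //= y; rewrite mulgA mulVg mul1g.
Qed.

Lemma null_conj s : null s -> null [seq fconj c a | a <- s].
Proof. by move/(conj_nullset c); rewrite mset_map_fsum. Qed.

(** Scaling the null sum [1 + eta] by the inverse of [eta] yields [eta^-1 + 1], and [eta] is unique.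
    Hence double negation is the identity. *)
Lemma etaV : ((eta T)^-1 = eta T)%g.
Proof.
apply: nullset_eta_uniq.
have /(null_scale_sub (eta T)^-1%g) : null [:: Some 1%g; Some (eta T)].
  exact: nullset_eta.
rewrite /= mulg1 mulVg; congr nullset.
by rewrite (@perm_fsum _ [:: Some 1%g;
  Some (eta T)^-1%g]) // (perm_catC [:: _] [:: _]).
Qed.

Lemma foppK : involutive (@fopp T).
Proof. by case=> //= x; rewrite mulgA -{1}etaV mulVg mul1g. Qed.

Lemma null1 a : null [:: a] -> a = None.
Proof.
case: a => // x /(null_scale_sub x^-1%g); rewrite /= mulVg => h.
by case: (@nullset1 T).
Qed.

Lemma null2 a b : null [:: a; b] -> a = fopp b.
Proof.
case: b => [y|]; last by move/null1.
case: a => [x|]; last by move/null1.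
move=> /(null_scale_sub y^-1%g); rewrite /= mulVg => h.
have e : (y^-1 * x = eta T)%g.
  apply: nullset_eta_uniq; move: h; congr nullset.
  exact: (@perm_fsum [:: Some _; Some _] [:: Some _; Some _])
    (permEl (perm_catC [:: _] [:: _])).
by rewrite -e tract_mulC mulgA mulgV mul1g.
Qed.

Lemma null_nil : null ([::] : seq (ext T)).
Proof. by move: (@nullset0 T); rewrite -[mset0]seq_mset_id enum_mset0. Qed.

Lemma null2P a b : a = fopp b -> null [:: a; b].
Proof.
move=> ->; case: b => [y|]; last exact: null_nil.
have /(null_scale_sub y) : null [:: Some 1%g; Some (eta T)].
  exact: nullset_eta.
rewrite /= mulg1 tract_mulC; congr nullset.
exact: (@perm_fsum [:: Some _; Some _] [:: Some _; Some _])
    (permEl (perm_catC [:: _] [:: _])).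
Qed.

(** The two factors [eta] cancel, as do [d] and its inverse. With [d] the conjugate of [Y e], this
    turns a term of an inner product into a term of a linear combination. *)
Lemma fmul_opp_cancel a b d : d != None ->
  fmul (fmul (Some (eta T)) (fmulinv d)) (fmul a (fopp (fmul b d))) = fmul a b.
Proof.
case: a d b => [x|] [z|] [y|] //= _; congr Some.
have mulCA u v w : (u * (v * w) = v * (u * w) :> T)%g.
  by rewrite mulgA (tract_mulC u v) -mulgA.
rewrite (tract_mulC y) (mulCA _ z) (mulCA _ z) -mulgA mulKg (mulCA x).
by rewrite -{1}etaV mulKg.
Qed.

Lemma fsum_support (I : finType) (F : I -> ext T) (s : seq I) :
  uniq s -> (forall i, i \notin s -> F i = None) ->
  fsum [seq F i | i : I] = fsum [seq F i | i <- s].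
Proof.
move=> us Fs.
have p : perm_eq (enum I) (s ++ [seq i <- enum I | i \notin s]).
  apply: uniq_perm => [||i].
  - exact: enum_uniq.
  - rewrite cat_uniq us (filter_uniq _ (enum_uniq _)) andbT /=.
    by apply/hasPn => i; rewrite mem_filter => /andP[].
  - rewrite mem_cat mem_filter mem_enum andbT; by case: (i \in s).
rewrite (perm_fsum (perm_map F p)) map_cat.
suff e : pmap id [seq F i | i <- [seq i <- enum I | i \notin s]] = [::].
  by rewrite /fsum pmap_cat e cats0.
by elim: (enum I) => //= i r IH; case: ifP => //= /Fs ->.
Qed.

Lemma fsum_cat0 s t : (forall a, a \in t -> a = None) ->
  fsum (s ++ t) = fsum s.
Proof.
move=> t0; rewrite /fsum pmap_cat; suff -> : pmap id t = [::] by rewrite cats0.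
elim: t t0 => //= a t IH t0; rewrite (t0 a) ?mem_head //=.
by apply: IH => b bt; apply: t0; rewrite in_cons bt orbT.
Qed.

Lemma null0 s : (forall a, a \in s -> a = None) -> null s.
Proof. by move=> s0; rewrite -[s]cat0s fsum_cat0 //; apply: null_nil. Qed.

Lemma hypersum0 s b : (forall a, a \in s -> a = None) -> hypersum s b ->
  b = None.
Proof.
move=> s0; rewrite /hypersum /= -cat1s fsum_cat0 // => /null1 /eqP.
by rewrite fopp_eq0 => /eqP.
Qed.

End Scalars.

Section HypersumOneTerm.
Variables (T : tract) (I : eqType) (s : seq I) (i : I) (F : I -> ext T).
Hypotheses (us : uniq s) (si : i \in s)
  (F0 : {in s, forall j, j != i -> F j = None}).

Lemma hypersum_one_term b : hypersum [seq F j | j <- s] b <-> b = F i.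
Proof.
have e : fsum (fopp b :: [seq F j | j <- s]) = fsum [:: fopp b; F i].
  rewrite (@perm_fsum _ _ ([:: fopp b; F i] ++ [seq F j | j <- rem i s])).
    rewrite fsum_cat0 // => _ /mapP[j + ->];
      rewrite mem_rem_uniq // => /andP[ji js].
    exact: F0.
  by rewrite perm_cons; exact: (perm_map F (perm_to_rem si)).
rewrite /hypersum /= e; split => [/null2/(can_inj (@foppK T))//|->].
exact: null2P.
Qed.

End HypersumOneTerm.

(** * Supports, scaling and orthogonality of vectors *)

Section Vectors.
Variables (T : tract) (c : conjugation T) (E : finType).
Implicit Types (X Y Z : vec T E) (e f j : E) (a : ext T) (B : {set E}).
Local Open Scope set_scope.

Lemma in_supp X e : (e \in supp X) = (X e != None).
Proof. by rewrite inE. Qed.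

Lemma supp0P X e : e \notin supp X -> X e = None.
Proof. by rewrite in_supp negbK => /eqP. Qed.

Lemma supp_vzero : supp (vzero : vec T E) = set0.
Proof. by apply/setP => e; rewrite !inE ffunE. Qed.

Lemma supp_neq0 X : X <> vzero <-> supp X != set0.
Proof.
split=> [X0|/eqP + X0]; last by rewrite X0 supp_vzero.
apply/eqP => s0; apply: X0; apply/ffunP => e; rewrite ffunE.
by apply: supp0P; rewrite s0 inE.
Qed.

Lemma supp_vscale a X : a != None -> supp (vscale a X) = supp X.
Proof.
by move=> a0; apply/setP => e; rewrite !inE ffunE fmul_eq0 (negPf a0).
Qed.

Lemma vscaleA a b X : vscale a (vscale b X) = vscale (fmul a b) X.
Proof. by apply/ffunP => e; rewrite !ffunE fmulA. Qed.

Lemma vscale1 X : vscale (Some 1%g) X = X.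
Proof. by apply/ffunP => e; rewrite !ffunE fmul1. Qed.

Definition orthogonal X Y := nullset (inner c X Y).
Local Notation orth := orthogonal.

Lemma inner_on X Y (s : seq E) : uniq s -> supp X :&: supp Y \subset s ->
  inner c X Y = fsum [seq fmul (X e) (fconj c (Y e)) | e <- s].
Proof.
move=> us /subsetP XYs; apply: fsum_support => // e es; apply/eqP.
rewrite fmul_eq0 fconj_eq0; apply: contraR es.
by rewrite negb_or => XY; apply: XYs; rewrite !inE.
Qed.

Lemma orth_sym X Y : orth X Y -> orth Y X.
Proof.
rewrite /orthogonal => /(@null_conj _ c); rewrite -map_comp.
congr (nullset (fsum _)); apply: eq_map => e /=.
by rewrite fconjM fconjK fmulC.
Qed.

Lemma orth_vscale a X Y : a != None -> orth (vscale a X) Y <-> orth X Y.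
Proof.
move=> a0; have := null_scale [seq fmul (X e) (fconj c (Y e)) | e : E] a0.
rewrite -map_comp => h; apply: iff_trans h;
  rewrite /orthogonal /inner /image_mem.
set s := map _ _; set t := map _ _; suff -> : s = t by [].
by apply: eq_map => e; rewrite /= ffunE fmulA.
Qed.

(** A sum with a single nonzero term is a multiple of [1], which is not null. Most exclusions of
    supports below come from this. *)
Lemma orth1 X Y e : e \in supp X -> e \in supp Y ->
  supp X :&: supp Y \subset [set e] -> ~ orth X Y.
Proof.
move=> eX eY XY; rewrite /orthogonal (@inner_on _ _ [:: e]) //; last first.
  by apply: subset_trans XY _; apply/subsetP => f; rewrite !inE.
move/null1/eqP; rewrite fmul_eq0 fconj_eq0.
by move: eX eY; rewrite !in_supp => /negPf-> /negPf->.
Qed.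

Lemma orth2 X Y e f : e != f -> supp X :&: supp Y \subset [set e; f] ->
  orth X Y <->
  fmul (X e) (fconj c (Y e)) = fopp (fmul (X f) (fconj c (Y f))).
Proof.
move=> ef XY; rewrite /orthogonal (@inner_on _ _ [:: e; f]) /= ?inE ?ef //;
  last first.
  by apply: subset_trans XY _; apply/subsetP => g; rewrite !inE.
by split=> [/null2//|?]; apply: null2P.
Qed.

Lemma vscale_perp (C : set (vec T E)) X (a : T) :
  perp c C X -> perp c C (vscale (Some a) X).
Proof. by move=> CX Y CY; apply/orth_vscale => //; apply: CX. Qed.

Lemma minsupp_exists (C : set (vec T E)) X :
  C X -> exists2 Y, minsupp C Y & supp Y \subset supp X.
Proof.
have [n] := ubnP #|supp X|; elim: n X => // n IH X nX CX.
have [[Y [CY YX]]|no] := pselect (exists Y, C Y /\ supp Y \proper supp X).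
  have [|Z CZ ZY] := IH Y _ CY.
    exact: leq_trans (proper_card YX) nX.
  by exists Z => //; apply: subset_trans ZY (proper_sub YX).
exists X => //; split=> // Y CY; apply/negP => YX; apply: no; by exists Y.
Qed.

Lemma minsupp_vscale (C : set (vec T E)) X (a : T) :
  (forall Y (b : T), C Y -> C (vscale (Some b) Y)) ->
  minsupp C X -> minsupp C (vscale (Some a) X).
Proof. by move=> CZ [CX mX]; split; [apply: CZ|rewrite supp_vscale]. Qed.

(** * Linear combinations of an echelon form as orthogonality conditions *)

Section Fundamental.
Variables (B : {set E}) (S : E -> vec T E).
Hypothesis SB : {in B, forall j, supp (S j) :&: B = [set j]}.

Lemma echelon_neq0 j : j \in B -> S j j != None.
Proof. by move/SB/setP/(_ j); rewrite !inE eqxx => /andP[]. Qed.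

Lemma echelon_eq0 j i : j \in B -> i \in B -> i != j -> S j i = None.
Proof.
move=> jB iB ij; apply: supp0P; apply/negP => iS.
by have /setP/(_ i) := SB jB; rewrite !inE -in_supp iS iB (negPf ij).
Qed.

(** Multiply the inner product of [X] and [Y] by minus the inverse of the conjugate of [Y e]. The
    term at [e] becomes [- X e]; by the two-term orthogonality of [S j] and [Y], the term at [j]
    becomes [a j] times [S j e]. Scaling preserves nullity. *)
Lemma hypersum_fundamental e Y X (a : E -> ext T) :
  e \notin B -> supp Y \subset e |: B -> Y e != None ->
  {in B, forall j, orth (S j) Y} ->
  {in B, forall j, X j = fmul (a j) (S j j)} ->
  orth X Y <->
  hypersum [seq Z e | Z : vec T E <- [seq vscale (a j) (S j) | j in B]] (X e).
Proof.
move=> eB YB Ye SY Xa; rewrite /orthogonal (@inner_on _ _ (e :: enum B));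
  last 2 first.
- by rewrite /= mem_enum eB enum_uniq.
- apply/subsetP => f; rewrite inE => /andP[_ /(subsetP YB)].
  by rewrite !inE mem_enum.
pose b := fmul (Some (eta T)) (fmulinv (fconj c (Y e))).
have cYe : fconj c (Y e) != None by rewrite fconj_eq0.
have b0 : b != None by move: cYe; rewrite /b; case: (fconj _ _).
rewrite -(null_scale _ b0) /hypersum /= -!map_comp.
suff -> : fmul b (fmul (X e) (fconj c (Y e))) = fopp (X e).
  have -> // : [seq (fmul b \o (fun f =>
    fmul (X f) (fconj c (Y f)))) i | i <- enum B]
    = [seq ((fun Z : vec T E => Z e) \o (fun j =>
      vscale (a j) (S j))) i | i <- enum B].
  apply/eq_in_map => j; rewrite mem_enum => jB /=; rewrite ffunE Xa // -fmulA.
  have ej : j != e by apply: contraNneq eB => <-.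
  have /(orth2 ej) -> := SY j jB; last first.
    apply/subsetP => f; rewrite inE => /andP[fS /(subsetP YB)].
    rewrite !inE => /orP[->|fB]; first by rewrite orbT.
    by have /setP/(_ f) := SB jB; rewrite !inE -in_supp fS fB => <-.
  exact: fmul_opp_cancel.
rewrite /b (fmulC (X e)) foppE -fmulA; congr fmul.
by rewrite fmulA [fmul (fmulinv _) _]fmulC fmulV // fmul1.
Qed.

(** A coordinate in [B] sees one nonzero term, so it forces [a j] to be [X j] divided by [S j j];
    the coordinates outside [B] are then the orthogonality conditions. *)
Lemma linear_combinationP (Y : E -> vec T E) X :
  (forall e, e \notin B -> [/\ supp (Y e) \subset e |: B, Y e e != None &
     {in B, forall j, orth (S j) (Y e)}]) ->
  linear_combination B S X <-> (forall e, e \notin B -> orth X (Y e)).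
Proof.
move=> YB; split=> [[a Xa] e eB|XY].
  have [? ? ?] := YB e eB; apply/(@hypersum_fundamental e (Y e) X a) => // i iB.
  have := Xa i; rewrite /image_mem -map_comp.
  move/(@hypersum_one_term _ _ (enum B) i) => ->;
    rewrite ?enum_uniq ?mem_enum //=.
    by rewrite ffunE.
  move=> j; rewrite mem_enum => jB ji /=; rewrite ffunE echelon_eq0 1?eq_sym //.
  exact: fmul0.
pose a j := fmul (X j) (fmulinv (S j j)).
have Xa : {in B, forall j, X j = fmul (a j) (S j j)}.
  move=> j jB; rewrite /a -fmulA [fmul (fmulinv _) _]fmulC fmulV ?echelon_neq0
    //.
  by rewrite fmulC fmul1.
exists a => e; have [eB|eB] := boolP (e \in B); last first.
  have [? ? ?] := YB e eB; apply/(hypersum_fundamental (Y := Y e)) => //.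
  exact: XY.
rewrite /image_mem -map_comp; apply/(@hypersum_one_term _ _ (enum B) e).
- exact: enum_uniq.
- by rewrite mem_enum.
- move=> j; rewrite mem_enum => jB ji /=; rewrite ffunE echelon_eq0 1?eq_sym //.
  exact: fmul0.
- by rewrite /= ffunE Xa.
Qed.

End Fundamental.

End Vectors.

(** * Circuits of a finite matroid *)

Section Height.
Variables (E : finType) (L : {set {set E}}).
Implicit Types (A B U : {set E}) (s : seq {set E}).
Local Open Scope set_scope.

(** A function that strictly increases along a chain is injective on it, so values at most [n] allow
    at most [n + 1] members. *)
Lemma height_le (phi : {set E} -> nat) U n :
  {in L &, forall A B, A \proper B -> B \subset U -> phi A < phi B} ->
  (forall A, A \subset U -> phi A <= n) -> height L U <= n.
Proof.
move=> phiS phin; apply/bigmax_leqP => P /andP[/subsetP PL /forallP Pc].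
suff: #|P| <= n.+1 by case: #|P|.
have inP A : A \in P -> A \in L /\ A \subset U.
  by move/PL; rewrite inE => /andP.
have inj : {in P &, injective (fun A => inord (phi A) : 'I_n.+1)}.
  move=> A B AP BP /(congr1 (@nat_of_ord _)).
  have [[AL AU] [BL BU]] := (inP A AP, inP B BP).
  rewrite !inordK ?ltnS ?phin // => eAB.
  have := Pc A; rewrite AP => /forallP/(_ B); rewrite BP /= => /orP[] sub.
    apply/eqP; apply: contraTT sub => AB.
    apply/negP => sub; have := phiS A B AL BL.
    by rewrite eAB ltnn properEneq AB sub BU => /(_ isT isT).
  apply/eqP; rewrite eq_sym; apply: contraTT sub => AB.
  apply/negP => sub; have := phiS B A BL AL.
  by rewrite eAB ltnn properEneq AB sub AU => /(_ isT isT).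
by rewrite -(card_in_imset inj) (leq_trans (max_card _)) // card_ord.
Qed.

(* Each member contributes a point outside the union of the later ones, so the
   unions of the tails of the list form a chain. *)
Fixpoint triangular s : bool :=
  if s is A :: s' then ~~ (A \subset \bigcup_(B <- s') B) && triangular s' else
    true.

(** The private point [e i] of [F i] lies in no other member of the list, hence witnesses
    [triangular] at [F i]. *)
Lemma triangular_cat (I : eqType) (F : I -> {set E}) (e : I ->
  E) (r : seq I) s :
  uniq r -> triangular s -> (forall i, e i \in F i) ->
  (forall i j, i != j -> e i \notin F j) ->
  (forall i, e i \notin \bigcup_(B <- s) B) ->
  triangular ([seq F i | i <- r] ++ s).
Proof.
move=> + ts eF eF' es; elim: r => //= i r IH /andP[ir ur]; rewrite IH // andbT.
apply/negP => /subsetP/(_ _ (eF i)); rewrite big_cat inE (negPf (es i)) orbF.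
rewrite big_map; apply/negP; elim: r ir {IH ur} => [|j r IH].
  by rewrite big_nil inE.
by rewrite inE negb_or big_cons inE negb_or => /andP[ij ir]; rewrite eF' ?IH.
Qed.

Hypotheses (L0 : set0 \in L) (LU : {in L &, forall A B, A :|: B \in L}).

Lemma lattice_bigcup s : {subset s <= L} -> \bigcup_(A <- s) A \in L.
Proof.
elim: s => [|A s IH] sL; first by rewrite big_nil.
rewrite big_cons; apply: LU; first by apply: sL; exact: mem_head.
by apply: IH => B Bs; apply: sL; rewrite inE Bs orbT.
Qed.

Lemma height_ge s U : {subset s <= L} -> triangular s ->
  \bigcup_(A <- s) A \subset U -> size s <= height L U.
Proof.
move=> sL ts sU.
(* The chain includes the empty union of the empty tail, so it has one member more than [s];
   [height] subtracts it again. *)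
suff [P [PL Pc Ps]] : exists P : {set {set E}},
    [/\ P \subset [set A in L | A \subset \bigcup_(A <- s) A], is_chain P &
        #|P| = (size s).+1].
  rewrite -[size s]/((size s).+1.-1) -Ps; apply: leq_bigmax_cond.
  rewrite Pc andbT; apply: subset_trans PL _; apply/subsetP => A.
  by rewrite !inE => /andP[-> /subset_trans->].
elim: s sL ts {sU} => [|A s IH] sL /=.
  exists [set set0]; split; last exact: cards1.
    by rewrite sub1set !inE L0 big_nil sub0set.
  by do 2!apply/forall_inP => ? /set1P->; rewrite subxx.
case/andP=> nA ts; have sL' : {subset s <= L}.
  by move=> B Bs; apply: sL; rewrite inE Bs orbT.
have [P [/subsetP PL Pc Ps]] := IH sL' ts.
set U' := \bigcup_(B <- _ :: s) B.
have Usub : \bigcup_(B <- s) B \subset U' by rewrite /U' big_cons subsetUr.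
have PU B : B \in P -> B \subset \bigcup_(B <- s) B.
  by move/PL; rewrite inE => /andP[].
exists (U' |: P); split.
- apply/subsetP => B; rewrite in_setU1 => /orP[/eqP->|BP].
    by rewrite inE subxx andbT lattice_bigcup.
  have:= PL B BP; rewrite !inE => /andP[-> BU] /=.
  exact: subset_trans BU Usub.
- apply/forall_inP => B /setU1P[->|BP]; apply/forall_inP => D /setU1P[->|DP].
  + by rewrite subxx.
  + by rewrite (subset_trans (PU D DP) Usub) orbT.
  + by rewrite (subset_trans (PU B BP) Usub).
  + by have /forall_inP/(_ B BP)/forall_inP/(_ D DP) := Pc.
rewrite cardsU1 Ps; suff -> : U' \notin P by [].
apply: contra nA => /PU; apply: subset_trans.
by rewrite /U' big_cons subsetUl.
Qed.

End Height.

(** * Unions of circuits, circuit elimination and nullity *)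

Section Circuits.
Variables (E : finType) (K : {set {set E}}).
Implicit Types (A B I U X Y Z : {set E}) (e f : E).
Local Open Scope set_scope.

Local Notation L := [set cover P | P in powerset K].

Lemma unionsP A :
  reflect {in A, forall x, exists2 X,
    X \in K & x \in X /\ X \subset A} (A \in L).
Proof.
apply: (iffP imsetP) => [[P] + -> x|AK].
  rewrite inE => /subsetP PK /bigcupP[X XP xX]; exists X; first exact: PK.
  by split=> //; apply: (bigcup_sup X).
exists [set X in K | X \subset A].
  by rewrite inE; apply/subsetP => X; rewrite inE => /andP[].
apply/setP => x; apply/idP/bigcupP => [/AK[X XK [xX XA]]|[X]].
  by exists X => //; rewrite inE XK.
by rewrite inE => /andP[_ /subsetP XA] /XA.
Qed.

Lemma unions0 : set0 \in L.
Proof. by apply/unionsP => x; rewrite inE. Qed.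

Lemma unions1 X : X \in K -> X \in L.
Proof. by move=> XK; apply/unionsP => x xX; exists X. Qed.

Lemma unionsU : {in L &, forall A B, A :|: B \in L}.
Proof.
move=> A B /unionsP AK /unionsP BK; apply/unionsP => x; rewrite inE.
case/orP=> [/AK|/BK] [X XK [xX XA]]; exists X => //; split=> //.
  by apply: subset_trans XA (subsetUl _ _).
by apply: subset_trans XA (subsetUr _ _).
Qed.

Definition indep I := [forall X in K, ~~ (X \subset I)].

Lemma indepP I : reflect {in K, forall X, ~~ (X \subset I)} (indep I).
Proof. exact: forall_inP. Qed.

Lemma indepPn I : reflect (exists2 X, X \in K & X \subset I) (~~ indep I).
Proof.
rewrite negb_forall; apply: (iffP existsP) => [[X]|[X XK XI]].
  by rewrite negb_imply negbK => /andP[]; exists X.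
by exists X; rewrite negb_imply XK negbK.
Qed.

Hypothesis K0 : set0 \notin K.
Hypothesis Kanti : {in K &, forall X Y, X \subset Y -> X = Y}.

Lemma indep0 : indep set0.
Proof.
by apply/indepP => X XK; apply: contra K0; rewrite subset0 => /eqP <-.
Qed.

Lemma circuit_atom X : X \in K -> is_atom L X.
Proof.
move=> XK; rewrite /is_atom unions1 //=; apply/andP; split.
  by apply: contra K0 => /eqP <-.
apply/forall_inP => B /unionsP BL; apply/implyP => BX.
apply/set0Pn => -[x xB]; have [Y YK [_ YB]] := BL x xB.
have YX := subset_trans YB (proper_sub BX).
by move: BX; rewrite -(Kanti YK XK YX) properE YB andbF.
Qed.

Lemma circuit_diff X : X \in K -> {in X, forall e, indep (X :\ e)}.
Proof.
move=> XK e eX; apply/indepP => Y YK; apply/negP => YX.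
have eYX : Y = X by apply: Kanti => //; apply: subset_trans YX (subD1set _ _).
by have := subsetP YX e; rewrite eYX eX !inE eqxx => /(_ isT).
Qed.

Hypothesis Kmod : {in K &, forall X Y, X != Y -> height L (X :|: Y) = 2 ->
  {in X :&: Y, forall e, exists2 Z, Z \in K & Z \subset (X :|: Y) :\ e}}.

(* In a counterexample with [X :|: Y] minimal, all circuits inside [X :|: Y]
   contain [e], hence by minimality any two of them have union [X :|: Y]; so
   [X], [Y] is a modular pair. *)
Lemma circuit_elim : {in K &, forall X Y, X != Y -> {in X :&: Y, forall e,
  exists2 Z, Z \in K & Z \subset (X :|: Y) :\ e}}.
Proof.
move=> X Y; have [n] := ubnP #|X :|: Y|.
elim: n X Y => // n IH X Y nXY XK YK XY e eXY; set U := X :|: Y.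
have [[Z /andP[ZK ZU]]|no] :=
    pselect (exists Z, (Z \in K) && (Z \subset U :\ e)); first by exists Z.
have eZ Z : Z \in K -> Z \subset U -> e \in Z.
  move=> ZK ZU; apply: contra_notT no => eZ; exists Z.
  by rewrite ZK subsetD1 ZU eZ.
have full Z1 Z2 : Z1 \in K -> Z2 \in K -> Z1 != Z2 ->
    Z1 :|: Z2 \subset U -> Z1 :|: Z2 = U.
  move=> K1 K2 ne sub; apply/eqP; rewrite eqEproper sub /=; apply/negP => pr.
  have sub1 : Z1 \subset U := subset_trans (subsetUl _ _) sub.
  have sub2 : Z2 \subset U := subset_trans (subsetUr _ _) sub.
  have [||Z ZK ZZ] := IH Z1 Z2 _ K1 K2 ne e.
  - exact: leq_trans (proper_card pr) nXY.
  - by rewrite inE !eZ.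
  have ZU : Z \subset U :\ e := subset_trans ZZ (setSD _ sub).
  by have := eZ Z ZK (subset_trans ZU (subD1set _ _));
    apply/negP; move: ZU; rewrite subsetD1 => /andP[].
apply: Kmod => //; apply/eqP; rewrite eqn_leq; apply/andP; split; last first.
  have := @height_ge E L unions0 unionsU [:: X; Y] U; apply => /=.
  - by move=> Z; rewrite !inE => /orP[]/eqP->; apply: unions1.
  - rewrite !big_seq1 big_nil subset0 andbT; apply/andP; split.
      by apply: contra XY => /(Kanti XK YK)->.
    by apply: contra K0 => /eqP <-.
  - by rewrite big_cons big_seq1.
(* By [full], a union of circuits inside [U] is empty, a single circuit, or [U] itself, so [phi] is
   strictly increasing on them and the height is at most 2. *)
pose phi A := if A == set0 then 0 else if A == U then 2 else 1.
apply: (@height_le E L phi) => [A B AL BL AB BU|A _]; last first.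
  by rewrite /phi; do 2?case: ifP.
have B0 : B == set0 = false.
  by apply/negbTE; apply: contraTneq AB => ->; rewrite properE sub0set andbF.
rewrite /phi; have [A0|A0] := eqVneq A set0.
  by rewrite B0; case: ifP.
have [BK|BU'] : B \in K \/ B = U.
- have [b bB] : exists b, b \in B by have /properP[_ [b]] := AB; exists b.
  have [Z1 K1 [_ Z1B]] := unionsP _ BL b bB.
  have [<-|Z1B'] := eqVneq Z1 B; first by left.
  right; have /properP[_ [x xB xZ1]] : Z1 \proper B.
    by rewrite properEneq Z1B' Z1B.
  have [Z2 K2 [xZ2 Z2B]] := unionsP _ BL x xB.
  have sub : Z1 :|: Z2 \subset B by rewrite subUset Z1B.
  apply/eqP; rewrite eqEsubset BU /= -(full Z1 Z2) //.
    by apply: contraNneq xZ1 => ->.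
  exact: subset_trans sub BU.
- have [a aA] := set0Pn _ A0; have [Z ZK [_ ZA]] := unionsP _ AL a aA.
  have ZB := subset_trans ZA (proper_sub AB).
  by move: AB; rewrite -(Kanti ZK BK ZB) properE ZA andbF.
rewrite B0; have -> : A == U = false; last by rewrite BU' eqxx.
by apply: negbTE; move: AB; rewrite BU' properEneq => /andP[].
Qed.

(** Plain elimination may produce [Z1] without [f]. Then pick [g] in [Z1] outside [X], eliminate [g]
    from [Y] and [Z1] keeping [e], and eliminate [e] from [X] and the result keeping [f]. Both
    unions are smaller than [X :|: Y]: the first lacks [f], the second lacks [g]. *)
Lemma strong_circuit_elim : {in K &, forall X Y, {in X :&: Y, forall e,
  {in X :\: Y, forall f, exists2 Z,
    Z \in K & (f \in Z) && (Z \subset (X :|: Y) :\ e)}}}.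
Proof.
move=> X Y; have [n] := ubnP #|X :|: Y|.
elim: n X Y => // n IH X Y nXY XK YK e eXY f fXY.
have [eX eY] := setIP eXY; have [fX fY] := setDP fXY.
have XY : X != Y by apply: contraNneq fY => <-.
have [Z1 K1 Z1XY] := circuit_elim XK YK XY eXY.
have [fZ1|fZ1] := boolP (f \in Z1); first by exists Z1; rewrite ?fZ1.
have [sZ1 eZ1] : Z1 \subset X :|: Y /\ e \notin Z1.
  by move: Z1XY; rewrite subsetD1 => /andP.
have /subsetPn[g gZ1 gX] : ~~ (Z1 \subset X).
  by apply: contraNN fZ1 => /(Kanti K1 XK)->.
have gY : g \in Y.
  by have := subsetP sZ1 g gZ1; rewrite inE (negPf gX).
have card (A : {set E}) h : A \subset X :|: Y -> h \in X :|: Y -> h \notin A ->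
    #|A| < n.
  move=> AXY hXY hA; apply: leq_trans (proper_card _) nXY.
  by apply/properP; split=> //; exists h.
have YZ1 : Y :|: Z1 \subset X :|: Y by rewrite subUset subsetUr.
have [|||Z2 K2 /andP[eZ2 Z2s]] := IH Y Z1 _ YK K1 g _ e.
- apply: (card _ f) => //; first by rewrite inE fX.
  by rewrite inE negb_or fY.
- by rewrite inE gY.
- by rewrite inE eY eZ1.
have [sZ2 gZ2] : Z2 \subset Y :|: Z1 /\ g \notin Z2.
  by move: Z2s; rewrite subsetD1 => /andP.
have fZ2 : f \notin Z2.
  by apply: contra fY => /(subsetP sZ2); rewrite inE (negPf fZ1) orbF.
have XZ2 : X :|: Z2 \subset X :|: Y.
  by rewrite subUset subsetUl (subset_trans sZ2).
have [|||Z3 K3 /andP[fZ3 Z3s]] := IH X Z2 _ XK K2 e _ f.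
- apply: (card _ g) => //; first by rewrite inE gY orbT.
  by rewrite inE negb_or gX.
- by rewrite inE eX.
- by rewrite inE fX fZ2.
by exists Z3 => //; rewrite fZ3 (subset_trans Z3s) // setSD.
Qed.

(** If every exchange fails, each [a] in [X :\: B] lies on a circuit inside [a |: B :\ g].
    Eliminating [a] with it while keeping [g] shrinks the part of the circuit outside [B], which can
    never become empty since [B] is independent. *)
Lemma indep_exchange B X g : indep B -> X \in K -> g \in X -> g \in B ->
  exists2 a, a \in X :\: B & indep (a |: B :\ g).
Proof.
move=> Bi XK gX gB.
have [//|no] := pselect (exists2 a, a \in X :\: B & indep (a |: B :\ g)).
suff h Z : Z \in K -> g \in Z -> Z :\: B \subset X :\: B -> False.
  by case: (h X XK gX (subxx _)).
have [n] := ubnP #|Z :\: B|; elim: n Z => // n IH Z nZ ZK gZ ZX.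
have /subsetPn[a aZ aB] := indepP _ Bi Z ZK.
have aZB : a \in Z :\: B by rewrite inE aB.
have /indepPn[Y YK Ys] : ~~ indep (a |: B :\ g).
  by apply/negP => ai; apply: no; exists a => //; apply: (subsetP ZX).
have aY : a \in Y.
  apply: contraLR (indepP _ Bi Y YK) => aY; rewrite negbK.
  apply/subsetP => y yY; have := subsetP Ys y yY.
  by rewrite !inE => /predU1P[ya|/andP[]//]; rewrite -ya yY in aY.
have gY : g \notin Y.
  apply/negP => /(subsetP Ys); rewrite !inE eqxx orbF => /eqP ga.
  by rewrite -ga gB in aB.
have [||Z' K' /andP[gZ' Z's]] := @strong_circuit_elim Z Y ZK YK a _ g _.
- by rewrite inE aZ.
- by rewrite inE gZ gY.
have Z'B : Z' :\: B \subset (Z :\: B) :\ a.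
  apply/subsetP => y; rewrite !inE => /andP[yB /(subsetP Z's)].
  rewrite !inE yB /= => /andP[ya /orP[yZ|/(subsetP Ys)]].
    by rewrite ya.
  by rewrite !inE (negPf ya) (negPf yB) andbF.
apply: (IH Z') => //.
  by apply: leq_ltn_trans (subset_leq_card Z'B) _; move: nZ;
    rewrite (cardsD1 a) aZB ltnS.
by apply: subset_trans Z'B (subset_trans (subD1set _ _) ZX).
Qed.

(** This is the cardinality of [A] minus its rank. The minimum runs over all independent [B], inside
    [A] or not; [set0] only shows that there is one. *)
Definition nullity A : nat :=
  #|A :\: [arg min_(B < set0 | indep B) #|A :\: B|]|.

Lemma nullity_le A B : indep B -> nullity A <= #|A :\: B|.
Proof.
by rewrite /nullity; case: arg_minnP => [|D _ minD Bi];
  [exact: indep0|exact: minD].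
Qed.

Lemma nullity_attained A : exists2 B, indep B & nullity A = #|A :\: B|.
Proof.
by rewrite /nullity; case: arg_minnP => [|D Di _]; [exact: indep0|exists D].
Qed.

(** Take [B] optimal for the larger set and [g] in the difference. If [g] is outside [B], then [B]
    leaves fewer points of the smaller set. Otherwise a circuit through [g] inside the larger set
    allows trading [g] for some [a]; the loss of [g] costs nothing in the smaller set, and [a] is
    gained. *)
Lemma nullity_lt : {in L &, forall A B, A \proper B -> nullity A < nullity B}.
Proof.
move=> A A' _ A'L /properP[AA' [g gA' gA]].
have [B Bi ->] := nullity_attained A'.
have sAA' : A :\: B \subset A' :\: B by apply: setSD.
have [gB|gB] := boolP (g \in B); last first.
  apply: leq_ltn_trans (nullity_le A Bi) (proper_card _).
  by apply/properP; split=> //; exists g; rewrite !inE gB // (negPf gA).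
have [X XK [gX XA']] := unionsP _ A'L g gA'.
have [a aX ai] := indep_exchange Bi XK gX gB.
have [aX' aB] := setDP aX.
apply: leq_ltn_trans (nullity_le A ai) (proper_card _).
apply/properP; split; last first.
  by exists a; rewrite !inE ?aB ?(subsetP XA') // eqxx.
apply/subsetP => x; rewrite !inE negb_or negb_and negbK => /andP[/andP[xa]].
case/orP=> [/eqP->|xB] xA; first by rewrite xA in gA.
by rewrite xB (subsetP AA').
Qed.

Lemma height_indep U B : indep B -> height L U <= #|U :\: B|.
Proof.
move=> Bi; apply: (@height_le E L nullity) => [A A' AL A'L AA' _|A AU].
  exact: nullity_lt.
apply: leq_trans (nullity_le _ Bi) (subset_leq_card _); exact: setSD.
Qed.

End Circuits.

(** * Vector sets *)

Section SupportBases.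
Variables (T : tract) (E : finType) (W : set (vec T E)).
Implicit Types (A B : {set E}) (X : vec T E).
Local Open Scope set_scope.

Definition hits B := forall X, W X -> X <> vzero -> B :&: supp X != set0.

Lemma support_basis_hits B : support_basis W B -> hits B.
Proof. by move=> /minsetP[/asboolP]. Qed.

Lemma support_basis_min B A : support_basis W B -> hits A -> A \subset B ->
  A = B.
Proof. by move=> /minsetP[_ minB] hA; apply: minB; apply/asboolP. Qed.

Lemma support_basis_sub A : hits A ->
  exists2 B, support_basis W B & B \subset A.
Proof.
move=> /asboolP hA; have [B sB BA] := minset_exists
  (P := fun A => `[< forall X, W X -> X <> vzero -> A :&: supp X != set0 >]) hA.
by exists B.
Qed.

(** If no vector of [W] met [B] in [j] alone, [B :\ j] would still meet all supports, against
    minimality. *)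
Lemma support_basis_rref B : support_basis W B -> exists S, nearly_rref W B S.
Proof.
move=> sB; suff /choice[S WS] : forall j, exists X : vec T E,
    j \in B -> W X /\ supp X :&: B = [set j] by exists S.
move=> j; have [jB|] := boolP (j \in B); last by exists vzero.
have [[X [WX X0 BX]]|no] := pselect (exists X, [/\ W X, X <> vzero &
    (B :\ j) :&: supp X = set0]).
  exists X => _; split=> //; apply/eqP; rewrite eqEsubset; apply/andP; split.
    apply/subsetP => i /setIP[iX iB]; rewrite inE; apply: contraT => ij.
    by move/setP/(_ i): BX; rewrite in_set0 in_setI iX !inE ij iB.
  have /set0Pn[i /setIP[iB iX]] := support_basis_hits sB WX X0.
  have [<-|ij] := eqVneq i j; first by rewrite sub1set in_setI iX.
  by move/setP/(_ i): BX; rewrite in_set0 in_setI iX !inE ij iB.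
suff BjB : B :\ j = B by move: jB; rewrite -BjB !inE eqxx.
apply: (support_basis_min sB); last exact: subD1set.
by move=> X WX X0; apply/eqP => BX; apply: no; exists X.
Qed.

Lemma support_basisI B : hits B ->
  {in B, forall j, exists X, W X /\ supp X :&: B = [set j]} ->
    support_basis W B.
Proof.
move=> hB jB; apply/minsetP; split; first exact/asboolP.
move=> A /asboolP hA AB; apply/eqP; rewrite eqEsubset AB; apply/subsetP => j.
move/jB => [X [WX XB]].
have X0 : X <> vzero.
  by move=> X0; move/setP/(_ j): XB; rewrite X0 supp_vzero set0I !inE eqxx.
have /set0Pn[i /setIP[iA iX]] := hA X WX X0.
by move/setP/(_ i): XB;
  rewrite in_setI iX (subsetP AB) // in_set1 => /esym/eqP <-.
Qed.

End SupportBases.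

(** * Vectors orthogonal to an echelon form *)

Section Echelon.
Variables (T : tract) (c : conjugation T) (E : finType).
Variables (B : {set E}) (S : E -> vec T E).
Implicit Types (X Y Z : vec T E) (e : E).
Hypothesis SB : {in B, forall j, supp (S j) :&: B = [set j]%SET}.
Local Open Scope set_scope.

Lemma fconj1 : fconj c (Some 1%g) = Some 1%g.
Proof. by congr Some; apply: (@mulgI _ (c 1%g)); rewrite -conjM !mulg1. Qed.

Lemma echelon_overlap e Y j : supp Y \subset e |: B -> j \in B ->
  supp (S j) :&: supp Y \subset [set j; e].
Proof.
move=> YB jB; apply/subsetP => i /setIP[iS /(subsetP YB)].
rewrite !inE => /predU1P[->|iB]; first by rewrite eqxx orbT.
by move/setP/(_ i): (SB jB); rewrite !inE -in_supp iS iB => <-.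
Qed.

Lemma fundamental_exists e : e \notin B -> exists Y, [/\ supp Y \subset e |: B,
  Y e != None & {in B, forall j, orthogonal c (S j) Y}].
Proof.
(* With [Y e] normalised to 1, orthogonality to [S i] is a two-term relation between the positions
   [i] and [e], solved here for [Y i]. *)
move=> eB; pose Y : vec T E := [ffun i => if i == e then Some 1%g else
  if i \in B then fconj c (fopp (fmul (S i e) (fmulinv (S i i)))) else None].
have YB : supp Y \subset e |: B.
  by apply/subsetP => i; rewrite !inE ffunE; case: (i == e) => //;
    case: (i \in B).
exists Y; split=> // [|j jB]; first by rewrite ffunE eqxx.
have je : j != e by apply: contraNneq eB => <-.
apply/(orth2 _ je); first exact: echelon_overlap.
rewrite !ffunE (negPf je) jB eqxx fconjK fconj1 fopp_fmulr fmulC; congr fopp.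
rewrite [RHS]fmulC fmul1 -fmulA [fmul (fmulinv _) _]fmulC fmulV ?(echelon_neq0
  SB) //.
by rewrite fmulC fmul1.
Qed.

Lemma fundamental_uniq e Y Z : e \notin B ->
  supp Y \subset e |: B -> {in B, forall j, orthogonal c (S j) Y} ->
  supp Z \subset e |: B -> {in B, forall j, orthogonal c (S j) Z} ->
    Y e = Z e -> Y = Z.
Proof.
move=> eB YB SY ZB SZ YZe; apply/ffunP => i.
have [->//|ie] := eqVneq i e.
have [iB|iB] := boolP (i \in B); last first.
  rewrite !supp0P //; first by apply: contra iB => /(subsetP ZB);
    rewrite !inE (negPf ie).
  by apply: contra iB => /(subsetP YB); rewrite !inE (negPf ie).
have /(orth2 c ie (echelon_overlap YB iB)) := SY i iB.
have /(orth2 c ie (echelon_overlap ZB iB)) := SZ i iB.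
rewrite YZe => <- /(congr1 (fmul (fmulinv (S i i)))).
rewrite !fmulA ![fmul (fmulinv _) _]fmulC fmulV ?(echelon_neq0 SB) // !fmul1.
exact: (can_inj (@fconjK T c)).
Qed.

Lemma orth_echelon_eq0 Z : supp Z \subset B ->
  {in B, forall j, orthogonal c (S j) Z} ->
  Z = vzero.
Proof.
move=> ZB SZ; apply: contrapT => /supp_neq0/set0Pn[j jZ].
have jB := subsetP ZB j jZ.
apply: (@orth1 _ c _ (S j) Z j) (SZ j jB) => //.
  by rewrite in_supp (echelon_neq0 SB).
by rewrite -(SB jB); apply: setIS.
Qed.

Lemma fundamental_scale e Y Z : e \notin B ->
  supp Y \subset e |: B -> {in B, forall j, orthogonal c (S j) Y} ->
    Y e != None ->
  supp Z \subset e |: B -> {in B, forall j, orthogonal c (S j) Z} ->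
    Z <> vzero ->
  exists a : T, Z = vscale (Some a) Y.
Proof.
move=> eB YB SY Ye ZB SZ Z0.
have Ze : Z e != None.
  apply/eqP => Ze; apply: Z0; apply: orth_echelon_eq0 => //.
  apply/subsetP => i iZ; have := subsetP ZB i iZ.
  by rewrite !inE => /predU1P[ie|//]; move: iZ; rewrite ie in_supp Ze.
have [a aE] : exists a : T, fmul (Z e) (fmulinv (Y e)) = Some a.
  by case: (Z e) (Y e) Ze Ye => [z|] [y|] //= _ _; eexists.
exists a; apply: (fundamental_uniq eB) => //.
- by rewrite supp_vscale.
- move=> j jB; apply: orth_sym; apply/orth_vscale => //; apply: orth_sym;
    exact: SY.
- by rewrite ffunE -aE -fmulA [fmul (fmulinv _) _]fmulC fmulV // fmulC fmul1.
Qed.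

End Echelon.

(** * Exchange and fundamental circuits of a vector set *)

Section VectorSetMatroid.
Variables (T : tract) (c : conjugation T) (E : finType) (W : set (vec T E)).
Implicit Types (X Y Z : vec T E) (A B U : {set E}).
Hypothesis W_vector_set : vector_set W.
Local Open Scope set_scope.

Local Notation orth := (orthogonal c).
Local Notation Wp := (perp c W).
Local Notation circ := (minsupp (Wp `\ vzero)%classic).

Lemma vector_setE X : W X <-> forall B, support_basis W B -> forall S,
  nearly_rref W B S -> linear_combination B S X.
Proof. by rewrite {1}W_vector_set. Qed.

Lemma orth_perp X Y : W X -> Wp Y -> orth X Y.
Proof. by move=> WX WY; apply: orth_sym; apply: WY. Qed.

Lemma rref_echelon B S : nearly_rref W B S ->
  {in B, forall j, supp (S j) :&: B = [set j]}.
Proof. by move=> WS j /WS[]. Qed.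

Lemma rref_orth B S Y : nearly_rref W B S -> Wp Y ->
  {in B, forall j, orth (S j) Y}.
Proof. by move=> WS WY j /WS[? _]; apply: orth_perp. Qed.

Lemma fundamental_family B S : nearly_rref W B S -> exists Y : E -> vec T E,
  forall e, e \notin B -> [/\ supp (Y e) \subset e |: B, Y e e != None &
     {in B, forall j, orth (S j) (Y e)}].
Proof.
move=> WS; suff /choice[Y YP] : forall e, exists Y : vec T E, e \notin B ->
  [/\ supp Y \subset e |: B, Y e != None & {in B, forall j,
    orth (S j) Y}] by exists Y.
move=> e.
have [eB|eB] := boolP (e \in B); first by exists vzero.
by have [Y] := fundamental_exists c (rref_echelon WS) eB; exists Y.
Qed.

(** Each [X] in [W] is a linear combination of the [S j], hence orthogonal to any family of
    fundamental vectors; the given [Y] is placed in such a family at index [e]. *)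
Lemma fundamental_perp B S e Y : support_basis W B -> nearly_rref W B S ->
  e \notin B -> supp Y \subset e |: B -> Y e != None ->
  {in B, forall j, orth (S j) Y} -> Wp Y.
Proof.
move=> sB WS eB YB Ye SY X WX; apply: orth_sym.
have [Y' Y'P] := fundamental_family WS.
have Y''P e' : e' \notin B -> let Z := if e' == e then Y else Y' e' in
    [/\ supp Z \subset e' |: B, Z e' != None & {in B, forall j, orth (S j) Z}].
  by move=> e'B /=; case: eqP => [->|_]; [split|exact: Y'P].
have /vector_setE/(_ B sB S WS) := WX.
by move/(linear_combinationP (rref_echelon WS) X Y''P)/(_ e eB); rewrite eqxx.
Qed.

Lemma fundamental_circuit B e : support_basis W B -> e \notin B ->
  exists Y, [/\ Wp Y, supp Y \subset e |: B & Y e != None].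
Proof.
move=> sB eB; have [S WS] := support_basis_rref sB.
have [Y YP] := fundamental_family WS; have [YB Ye SY] := YP e eB.
exists (Y e); split=> //; exact: fundamental_perp sB WS eB YB Ye SY.
Qed.

Lemma perp_support_basis B Z : support_basis W B -> Wp Z -> supp Z \subset B ->
  Z = vzero.
Proof.
move=> sB WZ ZB; have [S WS] := support_basis_rref sB.
exact: (orth_echelon_eq0 (rref_echelon WS) ZB (rref_orth WS WZ)).
Qed.

Lemma fundamental_perp_scale B e Y Z : support_basis W B -> e \notin B ->
  Wp Y -> supp Y \subset e |: B -> Y <> vzero ->
  Wp Z -> supp Z \subset e |: B -> Z <> vzero ->
  exists a : T, Z = vscale (Some a) Y.
Proof.
move=> sB eB WY YB Y0 WZ ZB Z0; have [S WS] := support_basis_rref sB.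
apply: (fundamental_scale (rref_echelon WS) eB YB (rref_orth WS WY) _ ZB
  (rref_orth WS WZ) Z0).
apply/eqP => Ye; apply: Y0; apply: (perp_support_basis sB WY).
apply/subsetP => i iY; have := subsetP YB i iY.
by rewrite !inE => /predU1P[ie|//]; move: iY; rewrite ie in_supp Ye.
Qed.

Lemma fundamental_minsupp B e Y : support_basis W B -> e \notin B ->
  Wp Y -> supp Y \subset e |: B -> Y <> vzero -> circ Y.
Proof.
move=> sB eB WY YB Y0; split=> // Z [WZ Z0]; apply/negP => ZY.
have ZB := subset_trans (proper_sub ZY) YB.
have [a ZYa] := fundamental_perp_scale sB eB WY YB Y0 WZ ZB Z0.
by move: ZY; rewrite ZYa supp_vscale // properxx.
Qed.

(** A vector of [W] missing the new set would meet [Y] in [j] alone, so the new set contains a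
    support basis [B'']. *)
Lemma support_basis_exchange B a Y j : support_basis W B -> a \notin B ->
  Wp Y -> supp Y \subset a |: B -> j \in B -> j \in supp Y ->
  support_basis W (a |: B :\ j).
Proof.
move=> sB aB WY YB jB jY; have [S WS] := support_basis_rref sB.
have SB := rref_echelon WS.
have hB' : hits W (a |: B :\ j).
  move=> X WX X0; have /set0Pn[i /setIP[iB iX]] := support_basis_hits sB WX X0.
  apply/negP => /eqP B'X.
  have XB k : k \in supp X -> k \in a |: B -> k = j.
    move=> kX kB; move/setP/(_ k): B'X; rewrite in_set0 in_setI kX andbT.
    by move: kB; rewrite !inE; case: (eqVneq k j) => //= _ ->.
  have ij : i = j by apply: XB => //; rewrite inE iB orbT.
  apply: (@orth1 _ c _ X Y j) (orth_perp WX WY); rewrite -?ij //;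
    first by rewrite ij.
  apply/subsetP => k /setIP[kX /(subsetP YB)/(XB k kX) ->].
  by rewrite inE ij.
have [B'' sB'' B''B'] := support_basis_sub hB'.
suff <- : B'' = a |: B :\ j by [].
(* If [B''] omits [i], then [S j] and [S i] can meet [B''] only in [a], so both contain [a]. The
   fundamental circuit of [j] over [B''] avoids [a], as otherwise it would meet [S i] in [a] alone;
   so it lies in [B] and vanishes, a contradiction. *)
apply/eqP; rewrite eqEsubset B''B' /=; apply: contraT => /subsetPn[i iB' iB''].
have aj : a != j by apply: contraNneq aB => ->.
have jB'' : j \notin B''.
  by apply/negP => /(subsetP B''B'); rewrite !inE eqxx orbF eq_sym (negPf aj).
have S0 k : k \in B -> S k <> vzero.
  by move=> kB S0; have := echelon_neq0 SB kB; rewrite S0 ffunE.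
have SB'' k l : k \in B -> k \notin B'' -> l \in B'' -> l \in supp (S k) ->
  l = a.
  move=> kB kB'' lB'' lS; have := subsetP B''B' l lB''.
  rewrite !inE => /predU1P[//|/andP[lj lB]].
  move/setP/(_ l): (SB k kB); rewrite !inE -in_supp lS lB => /esym/eqP lk.
  by rewrite lk (negPf kB'') in lB''.
have aB'' : a \in B''.
  have [W1 _] := WS j jB.
  have /set0Pn[l /setIP[lB'' lS]] := support_basis_hits sB'' W1 (S0 j jB).
  by rewrite -(SB'' j l).
have iB : i \in B.
  by move: iB'; rewrite !inE => /predU1P[ia|/andP[]//]; rewrite ia aB'' in iB''.
have ij : i != j.
  by apply: contraTneq iB' => ->; rewrite !inE eqxx orbF eq_sym.
have [Y'' [WY'' Y''B Y''j]] := fundamental_circuit sB'' jB''.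
have [WSi _] := WS i iB.
have /set0Pn[l /setIP[lB'' lS]] := support_basis_hits sB'' WSi (S0 i iB).
have aSi : a \in supp (S i) by rewrite -(SB'' i l).
have aY'' : a \notin supp Y''.
  apply/negP => aY''; apply: (orth1 aSi aY'') (orth_perp WSi WY'').
  apply/subsetP => k /setIP[kS /(subsetP Y''B)];
    rewrite !inE => /predU1P[kj|kB''].
    move/setP/(_ j): (SB i iB); rewrite !inE -in_supp -kj kS kj jB eq_sym.
    by rewrite (negPf ij).
  by rewrite (SB'' i k).
have Y''0 : Y'' = vzero.
  apply: (perp_support_basis sB) => //; apply/subsetP => k kY''.
  have := subsetP Y''B k kY''; rewrite !inE => /predU1P[->//|kB''].
  have := subsetP B''B' k kB''; rewrite !inE => /predU1P[ka|/andP[]//].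
  by rewrite ka (negPf aY'') in kY''.
by rewrite Y''0 ffunE in Y''j.
Qed.

(** Choose [B] with the largest intersection with [A]. For [a] in [A] outside [B], the fundamental
    circuit of [a] contains some [j] outside [A], and exchanging [j] for [a] enlarges the
    intersection. *)
Lemma extend_support_basis A : (forall Y, circ Y -> ~~ (supp Y \subset A)) ->
  exists2 B, support_basis W B & A \subset B.
Proof.
move=> Ai; have [B0 sB0 _] : exists2 B, support_basis W B & B \subset setT.
  by apply: support_basis_sub => X WX /supp_neq0; rewrite setTI.
pose sb := fun B : {set E} => `[< support_basis W B >].
have sb0 : sb B0 by apply/asboolP.
case: (arg_maxnP (fun B => #|A :&: B|) sb0) => B /asboolP sB maxB.
exists B => //; apply: contraT => /subsetPn[a aA aB].
have [Y [WY YB Ya]] := fundamental_circuit sB aB.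
have Y0 : Y <> vzero by move=> Y0; rewrite Y0 ffunE in Ya.
have /subsetPn[j jY jA] := Ai Y (fundamental_minsupp sB aB WY YB Y0).
have jB : j \in B.
  have := subsetP YB j jY; rewrite !inE => /predU1P[ja|//].
  by rewrite ja aA in jA.
have sB' := support_basis_exchange sB aB WY YB jB jY.
have /maxB : sb (a |: B :\ j) by apply/asboolP.
rewrite /= leqNgt => /negP[]; apply: proper_card; apply/properP; split.
  apply/subsetP => k /setIP[kA kB]; rewrite !inE kA kB andbT /=.
  by rewrite (contraNneq _ jA) ?orbT // => <-.
by exists a; rewrite !inE ?aA ?eqxx // (negPf aB) andbF.
Qed.

(** By minimality [supp Y :\ e] contains no circuit, so it extends to a support basis [B]; if [e]
    were in [B], then [Y] would be supported in [B] and vanish. *)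
Lemma circuit_fundamental Y e : circ Y -> e \in supp Y ->
  exists B, [/\ support_basis W B, e \notin B & supp Y \subset e |: B].
Proof.
move=> [[WY Y0] minY] eY.
have [|B sB YB] := @extend_support_basis (supp Y :\ e).
  move=> Z [[WZ Z0] _]; apply/negP => ZY; have /negP[] := minY Z (conj WZ Z0).
  exact: sub_proper_trans ZY (properD1 eY).
have YeB : supp Y \subset e |: B by rewrite -(setD1K eY) setUS.
exists B; split=> //; apply/negP => eB; apply: Y0.
by apply: (perp_support_basis sB WY); apply: subset_trans YeB _;
  rewrite subUset sub1set eB /=.
Qed.

(** Being a linear combination of an echelon form requires orthogonality to fundamental vectors
    only, and these have minimal support. *)
Lemma vector_set_perp_circuits : W = perp c circ.
Proof.
apply/seteqP; split=> X; first by move=> WX Y [[WY _] _]; apply: orth_perp.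
move=> CX; apply/vector_setE => B sB S WS.
have [Y YP] := fundamental_family WS.
apply/(linear_combinationP (rref_echelon WS) X YP) => e eB.
have [YB Ye SY] := YP e eB; apply: CX.
apply: (fundamental_minsupp sB eB) => //;
  first exact: fundamental_perp sB WS eB YB Ye SY.
by move=> Y0; rewrite Y0 ffunE in Ye.
Qed.

Lemma circ_neq0 : ~ circ vzero. Proof. by case=> -[_ []]. Qed.

Lemma circZ X (a : T) : circ X -> circ (vscale (Some a) X).
Proof.
apply: minsupp_vscale => Y b [WY Y0]; split; first exact: vscale_perp.
by move=> /= bY; apply: Y0; have := congr1 (vscale (Some b^-1%g)) bY;
   rewrite vscaleA /= mulVg vscale1 => ->; apply/ffunP => e; rewrite !ffunE.
Qed.

Lemma circ_supp X Y : circ X -> circ Y -> supp X \subset supp Y ->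
  exists a : T, X = vscale (Some a) Y.
Proof.
move=> [[WX X0] _] cY XY; have [[WY Y0] _] := cY.
have [e eY] := set0Pn _ (proj1 (supp_neq0 _) Y0).
have [B [sB eB YB]] := circuit_fundamental cY eY.
exact: (fundamental_perp_scale sB eB WY YB Y0 WX (subset_trans XY YB) X0).
Qed.

End VectorSetMatroid.

Section SupportLattice.
Variables (T : tract) (E : finType) (C : set (vec T E)).
Local Open Scope set_scope.

Lemma supportsP A : reflect (exists2 X, C X & supp X = A) (A \in supports C).
Proof. by rewrite inE; apply: asboolP. Qed.

Lemma supports_supp X : C X -> supp X \in supports C.
Proof. by move=> CX; apply/supportsP; exists X. Qed.

End SupportLattice.

Lemma bigcup_image_ord (E : finType) k (F : 'I_k -> {set E}) :
  (\bigcup_(A <- [seq F j | j : 'I_k]) A = \bigcup_j F j)%SET.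
Proof. by rewrite big_map big_enum. Qed.

(** * Strong modular elimination from a vector set *)

Section VectorSetElimination.
Variables (T : tract) (c : conjugation T) (E : finType) (W : set (vec T E)).
Hypothesis W_vector_set : vector_set W.
Local Open Scope set_scope.

Local Notation orth := (orthogonal c).
Local Notation Wp := (perp c W).
Local Notation circ := (minsupp (Wp `\ vzero)%classic).

Section Family.
Variables (k : nat) (X : vec T E) (Xs : 'I_k -> vec T E) (e : 'I_k ->
  E) (f : E).
Hypotheses (cX : circ X) (cXs : forall j, circ (Xs j)).
Hypotheses (fX : f \in supp X) (fXs : forall j, f \notin supp (Xs j)).
Hypothesis eXs : forall j, e j \in supp (Xs j).
Hypothesis eXs' : forall i j, i != j -> e i \notin supp (Xs j).
Hypothesis eE : forall j, X (e j) = fopp (Xs j (e j)).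

Let U := supp X :|: \bigcup_j supp (Xs j).
(** One private point per member of the family is removed; what remains will be completed to a
    support basis. *)
Let U' := U :\: (f |: [set e j | j : 'I_k]).

Hypothesis htU : height (support_lattice circ) U <= k.+1.

(** Such a circuit, appended to the [k + 1] members of the family, would give a triangular list of
    length [k + 2] inside [U], beyond its height. *)
Lemma modular_cobasis Y : circ Y -> ~~ (supp Y \subset U').
Proof.
move=> cY; apply/negP => YU'.
have YU'P x : x \in supp Y -> [/\ x \in U, x != f & forall j, x != e j].
  move/(subsetP YU')/setDP=> [xU]; rewrite in_setU1 negb_or => /andP[xf xe].
  split=> // j; apply: contraNneq xe => ->; exact: imset_f.
pose s := supp X :: ([seq supp (Xs j) | j <- enum 'I_k] ++ [:: supp Y]).
have := @height_ge E _ (unions0 (supports circ)) (@unionsU _ (supports circ)) s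
  U.
have -> : size s = k.+2 by rewrite /= size_cat size_map size_enum_ord addn1.
have U_s : \bigcup_(A <- s) A \subset U.
  rewrite big_cons big_cat bigcup_image_ord big_seq1 subUset subsetUl /=.
  rewrite subUset subsetUr /=; exact: subset_trans YU' (subsetDl _ _).
suff ts : triangular s.
  have sL : {subset s <= support_lattice circ}.
    move=> A; rewrite inE mem_cat mem_seq1 =>
      /or3P[/eqP->|/mapP[j _ ->]|/eqP->];
    exact/unions1/supports_supp.
  by move=> /(_ sL ts U_s) h; have := leq_trans h htU; rewrite ltnn.
apply/andP; split.
  apply/negP => /subsetP/(_ f fX);
    rewrite big_cat bigcup_image_ord big_seq1 in_setU.
  case/orP=> [|/YU'P[_]]; last by rewrite eqxx.
  by move=> /bigcupP[j _]; apply/negP.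
apply: (@triangular_cat _ _ (fun j => supp (Xs j)) e) => //.
- exact: enum_uniq.
- rewrite /= big_nil subset0 andbT; have [[_ Y0] _] := cY.
  exact/supp_neq0.
- by move=> i; rewrite big_seq1; apply/negP => /YU'P[_ _ /(_ i)]; rewrite eqxx.
Qed.

(** Over a support basis [B] containing [U'], each [Xs j] is fundamental at [e j]. The required [Z]
    is the fundamental circuit at [f], scaled to agree with [X] at [f]. *)
Lemma modular_elim_family : exists Z, [/\ circ Z, forall j, Z (e j) = None &
  vhypersum (X :: [seq Xs j | j : 'I_k]) Z].
Proof.
have [B sB U'B] := extend_support_basis W_vector_set modular_cobasis.
have [S WS] := support_basis_rref sB.
have SB := rref_echelon WS.
have fe j : f != e j by apply: contraNneq (fXs j) => ->.
have UP x : x \in U -> [\/ x \in B, x = f | exists j, x = e j].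
  move=> xU; have [/(subsetP U'B)|] := boolP (x \in U'); first by constructor 1.
  rewrite in_setD xU andbT negbK => /setU1P[|/imsetP[j _ ->]];
    first by constructor 2.
  by constructor 3; exists j.
have XU : {subset supp X <= U} by apply/subsetP; exact: subsetUl.
have XsU j : {subset supp (Xs j) <= U}.
  move=> x xX; rewrite in_setU; apply/orP; right; apply/bigcupP; by exists j.
have XsB j : supp (Xs j) \subset e j |: B.
  apply/subsetP => x xX; rewrite in_setU1.
  have [->|xf|[i xi]] := UP x (XsU j x xX); first by rewrite orbT.
    by move: xX; rewrite xf (negPf (fXs j)).
  have [<-|ij] := eqVneq i j; first by rewrite xi eqxx.
  by move: xX; rewrite xi (negPf (eXs' ij)).
have WX : Wp X by case: cX => -[].
have WXs j : Wp (Xs j) by case: (cXs j) => -[].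
have eB j : e j \notin B.
  apply/negP => ejB; have [[_ Xj0] _] := cXs j; apply: Xj0.
  apply: (perp_support_basis sB) => //; apply: subset_trans (XsB j) _.
  by rewrite subUset sub1set ejB subxx.
(* If [f] were in [B], then [S f] would avoid each [e j], lest it meet [Xs j] in [e j] alone; then
   it would meet [X] in [f] alone. *)
have fB : f \notin B.
  apply/negP => fB; have [WSf _] := WS f fB.
  have Sf j : e j \notin supp (S f).
    apply/negP => ejS; apply: (orth1 ejS (eXs j)) (orth_perp WSf (WXs j)).
    apply/subsetP => x xS; have := subsetP (echelon_overlap SB (XsB j) fB) x xS.
    case/set2P=> [xf|->]; last exact: set11.
    by have /setIP[_] := xS; rewrite xf (negPf (fXs j)).
  apply: (@orth1 _ c _ (S f) X f) (orth_perp WSf WX) => //.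
    by rewrite in_supp (echelon_neq0 SB).
  apply/subsetP => x /setIP[xS xX]; have [xB|->|[j xj]] := UP x (XU x xX).
  - by rewrite -(SB f fB) in_setI xS.
  - exact: set11.
  - by rewrite xj (negPf (Sf j)) in xS.
have [Z0 [WZ0 Z0B Z0f]] := fundamental_circuit c W_vector_set sB fB.
have Z00 : Z0 <> vzero by move=> h; rewrite h ffunE in Z0f.
have [a aE] : exists a : T, fmul (X f) (fmulinv (Z0 f)) = Some a.
  by move: fX Z0f; rewrite in_supp; case: (X f) (Z0 f) => [x|] [y|] //= _ _;
    eexists.
set Z := vscale (Some a) Z0.
have cZ0 := fundamental_minsupp sB fB WZ0 Z0B Z00.
have cZ : circ Z := circZ a cZ0.
have ZB : supp Z \subset f |: B by rewrite supp_vscale.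
have Zf : Z f = X f by rewrite ffunE -aE -fmulA [fmul (fmulinv _) _]fmulC fmulV
  // fmulC fmul1.
have WZ : Wp Z by case: cZ => -[].
have Ze j : Z (e j) = None.
  apply: supp0P; apply/negP => /(subsetP ZB).
  by rewrite in_setU1 eq_sym (negPf (fe j)) (negPf (eB j)).
exists Z; split=> // x; rewrite /image_mem /= -map_comp.
(* Outside [B], at [f] only [X] and [Z] are nonzero and they agree; at [e j] only [X] and [Xs j] are
   nonzero and they cancel; elsewhere every term is zero. *)
have [xB|xB] := boolP (x \in B); last first.
  have [->|xf] := eqVneq x f.
    rewrite /hypersum /= -[_ :: X f :: _]/([:: fopp (Z f); X f] ++ _) fsum_cat0.
      by apply: null2P; rewrite Zf.
    by move=> _ /mapP[j _ ->] /=; apply: supp0P; apply: fXs.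
  have Zx : Z x = None.
    by apply: supp0P; apply/negP => /(subsetP ZB);
      rewrite in_setU1 (negPf xf) (negPf xB).
  have [[j ->]|xe] := pselect (exists j, x = e j).
    rewrite /hypersum /= Ze eE;
      apply/(@hypersum_one_term _ _ (enum 'I_k) j) => //.
    - exact: enum_uniq.
    - exact: mem_enum.
    - by move=> i _ ij /=; apply: supp0P; apply: eXs'; rewrite eq_sym.
  have xU : x \notin U.
    by apply/negP => /UP[/(negP xB)|/eqP/(negP xf)|].
  apply: null0 => b; rewrite !in_cons Zx =>
    /or3P[/eqP->//|/eqP->|/mapP[j _ ->] /=].
    by apply: supp0P; apply: contra xU => /XU.
  by apply: supp0P; apply: contra xU => /XsU.
(* For [x] in [B], the inner product of [X] and [S x] lives on [x], [f] and the [e j]. Orthogonality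
   of [S x] to [Z] and to [Xs j] rewrites the terms at [f] and [e j] as [- d] times [Z x] and [d]
   times [Xs j x]; dividing by [d] leaves the hypersum at [x]. *)
have [WSx _] := WS x xB; pose d := fconj c (S x x).
have d0 : d != None by rewrite fconj_eq0 (echelon_neq0 SB).
have xf : x != f by apply: contraNneq fB => <-.
have xe j : x != e j by apply: contraNneq (eB j) => <-.
have e_inj : injective e.
  by move=> i j eij; apply/eqP; apply: contraT => /eXs'; rewrite eij eXs.
have : orth X (S x) by apply: orth_sym; exact: orth_perp WSx WX.
rewrite /orthogonal (@inner_on _ c _ _ _ (x :: f :: [seq e j | j <- enum
  'I_k])); last 2 first.
- have notin_e y : (forall j, y != e j) -> y \notin [seq e j | j <- enum 'I_k].
    by move=> ye; apply/mapP => -[j _ yj]; move: (ye j); rewrite yj eqxx.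
  by rewrite /= in_cons negb_or xf !notin_e //= map_inj_uniq // enum_uniq.
- apply/subsetP => y /setIP[yX yS]; rewrite !in_cons.
  have [yB|->|[j ->]] := UP y (XU y yX); last 2 first.
  + by rewrite eqxx orbT.
  + by rewrite map_f ?orbT // mem_enum.
  have : y \in supp (S x) :&: B by rewrite in_setI yS.
  by rewrite (SB x xB) => /set1P->; rewrite eqxx.
have orthS Y y : Wp Y -> y != x -> supp Y \subset y |: B ->
    fmul (Y y) (fconj c (S x y)) = fopp (fmul d (Y x)).
  move=> WY yx YB; rewrite [fmul d _]fmulC; apply/(orth2 c yx).
    by rewrite setIC setUC; exact: (echelon_overlap SB YB xB).
  by apply: orth_sym; exact: orth_perp WSx WY.
have -> : [seq fmul (X y) (fconj c (S x y)) |
      y <- [:: x, f & [seq e j | j <- enum 'I_k]]]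
  = [seq fmul d b | b <- [:: X x, fopp (Z x) &
      [seq ((fun Y : vec T E => Y x) \o Xs) j | j <- enum 'I_k]]].
  rewrite !map_cons -!map_comp [fmul d (X x)]fmulC -Zf.
  rewrite (orthS Z f WZ _ ZB) 1?eq_sym // fopp_fmulr; congr [:: _, _ & _].
  apply: eq_map => j /=.
  by rewrite eE fopp_fmull (orthS (Xs j) (e j) (WXs j) _ (XsB j)) 1?eq_sym //
    foppK.
rewrite null_scale //; congr nullset.
exact: perm_fsum (permEl (perm_catCA [:: _] [:: _] _)).
Qed.

End Family.

Lemma vector_set_elim : strong_modular_elimination circ.
Proof.
move=> k X Xs e [uX cX _ htX] /subsetPn[f fX fXs] eXXs eE.
have cXs j : circ (Xs j) by apply: cX; rewrite in_cons map_f ?orbT // mem_enum.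
have eP j := setDP (eXXs j).
apply: (@modular_elim_family k X Xs e f) => //.
- by apply: cX; exact: mem_head.
- by move=> j; apply: contra fXs => fj; apply/bigcupP; exists j.
- by move=> j; have [/setIP[]] := eP j.
- move=> i j ij; have [_] := eP i; apply: contra => eij.
  by apply/bigcupP; exists j; rewrite // eq_sym.
- move: htX; rewrite big_cons big_map big_enum /= size_map size_enum_ord => ->.
  exact: leqnn.
Qed.

Lemma vector_set_matroid : exists M : strong_matroid T E,
  [/\ W = covectors c M,
    cocircuits c M = minsupp (covectors c M `\ vzero)%classic &
      circuits M = minsupp (perp c (covectors c M) `\ vzero)%classic].
Proof.
exists (StrongMatroid (@circ_neq0 T c E W) (@circZ T c E W)
  (circ_supp W_vector_set) vector_set_elim).
by rewrite /covectors /cocircuits /= -vector_set_perp_circuits.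
Qed.

End VectorSetElimination.

(** * Vectors and covectors of a strong matroid *)

Section VectorSetCriterion.
Variables (T : tract) (c : conjugation T) (E : finType).
Variables (bases : set {set E}) (Q : set (vec T E)).
Implicit Types (X Y Z : vec T E) (B : {set E}).
Local Open Scope set_scope.
Local Notation W := (perp c Q).

Hypothesis fund_dual : forall B e, bases B -> e \notin B ->
  exists Y, [/\ Q Y, supp Y \subset e |: B & Y e != None].
Hypothesis fund : forall B j, bases B -> j \in B ->
  exists X, W X /\ supp X :&: B = [set j].
Hypothesis cover_dual : forall Y, Q Y -> exists B e,
  [/\ bases B, e \notin B, supp Y \subset e |: B & Y e != None].
Hypothesis support_basis_comparable : forall B, support_basis W B ->
  exists2 B', bases B' & (B \subset B') || (B' \subset B).

(** The vectors from [fund_dual] make a base meet all supports, those from [fund] make it minimal.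
    Minimal sets that are comparable coincide, so every support basis is a base. *)
Lemma support_basisE B : support_basis W B <-> bases B.
Proof.
have basesP B0 : bases B0 -> support_basis W B0.
  move=> bB; apply: support_basisI => [X WX /supp_neq0/set0Pn[i iX]|j jB];
    last first.
    by have [X] := fund bB jB; exists X.
  apply/eqP => BX0; have BX k : k \in B0 -> k \notin supp X.
    by move=> kB; apply/negP => kX; move/setP/(_ k): BX0;
      rewrite in_setI kB kX in_set0.
  have iB : i \notin B0 by apply: contraL iX; exact: BX.
  have [Y [QY YB Yi]] := fund_dual bB iB.
  apply: (@orth1 _ c _ X Y i) (WX Y QY) => //; first by rewrite in_supp.
  apply/subsetP => k /setIP[kX /(subsetP YB)/setU1P[->|/BX]];
    first exact: set11.
  by rewrite kX.
split=> [sB|]; last exact: basesP.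
have [B' bB' /orP[BB'|B'B]] := support_basis_comparable sB.
  by rewrite (support_basis_min (basesP _ bB') (support_basis_hits sB) BB').
by rewrite -(support_basis_min sB (support_basis_hits (basesP _ bB')) B'B).
Qed.

(** Vectors of [W] are orthogonal to the fundamental vectors, which lie in [Q]. Conversely each [Y]
    in [Q] is fundamental for some base by [cover_dual], so all linear combination conditions
    together give orthogonality to [Q]. The criterion serves for circuits with bases and for
    cocircuits with complements of bases. *)
Lemma perp_vector_set : vector_set W.
Proof.
have family B (S : E -> vec T E) : bases B -> nearly_rref W B S ->
  exists Y : E -> vec T E, forall e,
    e \notin B -> Q (Y e) /\ [/\ supp (Y e) \subset e |: B, Y e e != None &
      {in B, forall j, orthogonal c (S j) (Y e)}].
  move=> bB WS; suff /choice[Y YP] : forall e, exists Y : vec T E, e \notin B ->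
    Q Y /\ [/\ supp Y \subset e |: B, Y e != None & {in B, forall j,
      orthogonal c (S j) Y}].
    by exists Y.
  move=> e; have [eB|eB] := boolP (e \in B); first by exists vzero.
  have [Y [QY YB Ye]] := fund_dual bB eB; exists Y => _; split=> //; split=> //.
  by move=> j jB; have [WSj _] := WS j jB; apply: WSj.
apply/seteqP; split=> X.
  move=> WX B /support_basisE bB S WS; have [Y YP] := family B S bB WS.
  apply/(linear_combinationP (rref_echelon WS) X (fun e eB => proj2 (YP e eB))).
  by move=> e eB; have [QY _] := YP e eB; apply: WX.
move=> lcX Y QY; have [B [e [bB eB YB Ye]]] := cover_dual QY.
have sB := proj2 (support_basisE B) bB.
have [S WS] := support_basis_rref sB; have [Y' Y'P] := family B S bB WS.
have Y''P e' : e' \notin B -> let Z := if e' == e then Y else Y' e' in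
    [/\ supp Z \subset e' |: B, Z e' != None & {in B, forall j,
      orthogonal c (S j) Z}].
  move=> e'B /=; case: (eqVneq e' e) => [->|_]; last by have [] := Y'P e' e'B.
  by split=> // j jB; have [WSj _] := WS j jB; apply: WSj.
have := lcX B sB S WS.
by move/(linear_combinationP (rref_echelon WS) X Y''P)/(_ e eB); rewrite eqxx.
Qed.

End VectorSetCriterion.

(** * Bases and covectors of a strong matroid *)

Section StrongMatroid.
Variables (T : tract) (c : conjugation T) (E : finType) (M : strong_matroid T
  E).
Implicit Types (X Y Z : vec T E) (A B I : {set E}) (e f j : E).
Local Open Scope set_scope.

Local Notation C := (circuits M).
Local Notation K := (supports C).
Local Notation orth := (orthogonal c).

Lemma circuit_supp_neq0 : set0 \notin K.
Proof.
apply/supportsP => -[X CX X0]; apply: (@circuits_neq0 _ _ M).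
suff <- : X = vzero by []; apply: contrapT => /supp_neq0.
by rewrite X0 eqxx.
Qed.

Lemma circuit_supp_anti : {in K &, forall A B, A \subset B -> A = B}.
Proof.
move=> _ _ /supportsP[X CX <-] /supportsP[Y CY <-] XY.
by have [a ->] := circuits_supp CX CY XY; rewrite supp_vscale.
Qed.

Lemma circuit_supp_elim : {in K &, forall A B, A != B ->
  height [set cover P | P in powerset K] (A :|: B) = 2 -> {in A :&: B, forall e,
  exists2 D, D \in K & D \subset (A :|: B) :\ e}}.
Proof.
move=> _ _ /supportsP[X CX <-] /supportsP[Y CY <-] XY ht e /setIP[eX eY].
(* Scaling [Y] by this [a] makes it opposite to [X] at [e], as strong modular elimination with
   [k = 1] demands. *)
have [a aE] : exists a : T, fopp (fmul (X e) (fmulinv (Y e))) = Some a.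
  by move: eX eY; rewrite !in_supp; case: (X e) (Y e) => [x|] [y|] //= _ _;
    eexists.
pose Xs (j : 'I_1) := vscale (Some a) Y.
have XsE : [seq Xs j | j : 'I_1] = [:: vscale (Some a) Y].
  by rewrite /image_mem; have := size_enum_ord 1; case: (enum _) => [|i []].
have sXs : supp (vscale (Some a) Y) = supp Y by rewrite supp_vscale.
have CXs : C (vscale (Some a) Y) by apply: circuitsZ.
have nXY : ~~ (supp X \subset supp Y).
  by apply: contra XY => /(circuit_supp_anti (supports_supp CX) (supports_supp
    CY))->.
have inC : {in [:: X; vscale (Some a) Y], forall Z, C Z}.
  by move=> Z; rewrite !inE => /orP[]/eqP->.
have [||j|j|Z [CZ Ze Zh]] := @circuits_elim _ _ M 1 X Xs (fun=> e).
- rewrite XsE; split=> //.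
  + rewrite /= inE andbT; apply: contra nXY => /eqP->; by rewrite sXs.
  + move=> Z /inC CZ; apply: circuit_atom (supports_supp CZ).
      exact: circuit_supp_neq0.
    exact: circuit_supp_anti.
  + by rewrite big_cons big_seq1 sXs.
- by rewrite big_ord1 sXs.
- apply/setDP; split; first by rewrite in_setI eX sXs.
  by apply/bigcupP => -[i]; rewrite (ord1 i) (ord1 j).
- rewrite ffunE -aE fopp_fmull foppK -fmulA [fmul (fmulinv _) _]fmulC fmulV;
    last first.
    by rewrite -in_supp.
  by rewrite fmulC fmul1.
exists (supp Z); first exact: supports_supp.
rewrite subsetD1 in_supp (Ze ord0) eqxx andbT; apply/subsetP => x.
apply: contraLR; rewrite in_setU negb_or => /andP[xX xY].
rewrite in_supp negbK; apply/eqP; have := Zh x; rewrite XsE; apply: hypersum0.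
move=> b; rewrite !inE => /orP[]/eqP->; first exact: supp0P.
by rewrite supp0P // sXs.
Qed.

Local Notation indepM := (indep K).
Definition basis B := maxset indepM B.

Lemma basis_indep B : basis B -> indepM B.
Proof. exact: maxsetp. Qed.

Lemma basis_extend I : indepM I -> exists2 B, basis B & I \subset B.
Proof. by move=> Ii; have [B bB IB] := maxset_exists Ii; exists B. Qed.

Lemma dependent_circuit I e : indepM I -> ~~ indepM (e |: I) ->
  exists Y, [/\ C Y, supp Y \subset e |: I & e \in supp Y].
Proof.
move=> Ii /indepPn[A /supportsP[Y CY <-] YI]; exists Y; split=> //.
have /subsetPn[x xY xI] := indepP _ _ Ii _ (supports_supp CY).
by have := subsetP YI x xY; rewrite in_setU1 (negPf xI) orbF => /eqP <-.
Qed.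

Lemma basis_circuit B e : basis B -> e \notin B ->
  exists Y, [/\ C Y, supp Y \subset e |: B & Y e != None].
Proof.
move=> bB eB; have := dependent_circuit (e := e) (basis_indep bB).
case=> [|Y [CY YB eY]]; last by exists Y; rewrite -in_supp.
apply: contra eB => ei; have /maxsetP[_ /(_ _ ei (subsetUr _ _)) <-] := bB.
by rewrite in_setU1 eqxx.
Qed.

(** Both circuits contain [e]; if their supports differed, eliminating [e] would leave a circuit
    inside [B]. *)
Lemma basis_circuit_uniq B e Y Z : indepM B -> C Y -> supp Y \subset e |: B ->
  C Z -> supp Z \subset e |: B -> exists a : T, Z = vscale (Some a) Y.
Proof.
move=> Bi CY YB CZ ZB; apply: (circuits_supp CZ CY).
have [->|ne] := eqVneq (supp Z) (supp Y); first exact: subxx.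
have inX X : C X -> supp X \subset e |: B -> e \in supp X.
  move=> CX XB; apply: contraLR (indepP _ _ Bi _ (supports_supp CX)) => eX.
  rewrite negbK; apply/subsetP => x xX; have := subsetP XB x xX.
  by rewrite in_setU1 => /predU1P[xe|//]; rewrite xe (negPf eX) in xX.
have [|D KD] := @circuit_elim _ _ circuit_supp_neq0 circuit_supp_anti
    circuit_supp_elim _ _ (supports_supp CZ) (supports_supp CY) ne e.
  by rewrite in_setI !inX.
rewrite subsetD1 => /andP[DYZ eD].
have /negP[] := indepP _ _ Bi _ KD; apply/subsetP => x xD.
have : x \in e |: B by apply: subsetP xD; apply: subset_trans DYZ _;
  rewrite subUset ZB.
by rewrite in_setU1 => /predU1P[xe|//]; rewrite xe (negPf eD) in xD.
Qed.

(* Modular elimination of all but one of the elements of [supp X :\: B] from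
   [X] leaves a multiple of the remaining fundamental circuit. *)
Lemma basis_circuit_orth B (Y : E ->
  vec T E) (S : vec T E) j X : indepM B -> j \in B ->
  (forall e, e \notin B ->
    [/\ C (Y e), supp (Y e) \subset e |: B & Y e e = Some 1%g]) ->
  S j = Some 1%g -> {in B, forall e, e != j -> S e = None} ->
  (forall e, e \notin B -> fconj c (S e) = fopp (Y e j)) ->
  C X -> orth X S.
Proof.
move=> Bi jB YP Sj SB SY CX.
case fsE : (enum (supp X :\: B)) => [|f0 fs].
  have /negP[] := indepP _ _ Bi _ (supports_supp CX).
  by rewrite -setD_eq0; apply/eqP/setP => x; rewrite -mem_enum fsE in_set0.
have fsP f : f \in f0 :: fs -> f \in supp X /\ f \notin B.
  by rewrite -fsE mem_enum => /setDP.
have [f0X f0B] := fsP f0 (mem_head _ _).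
have /andP[f0fs ufs] : uniq (f0 :: fs) by rewrite -fsE enum_uniq.
pose k := size fs; pose e (i : 'I_k) := tnth (in_tuple fs) i.
have efs i : e i \in fs by exact: mem_tnth.
have eP i : e i \in supp X /\ e i \notin B by apply: fsP;
  rewrite in_cons efs orbT.
have e_inj : injective e by apply/tuple_uniqP.
(* Since [Y (e i)] is 1 at [e i], this multiple cancels [X] there. The point [f0], the head of the
   enumeration of [supp X :\: B], is the one not eliminated. *)
pose Xs i := vscale (fopp (X (e i))) (Y (e i)).
have Xe0 i : fopp (X (e i)) != None by rewrite fopp_eq0 -in_supp;
  have [] := eP i.
have sXs i : supp (Xs i) = supp (Y (e i)) by rewrite supp_vscale.
have XsB i : supp (Xs i) \subset e i |: B by rewrite sXs;
  have [] := YP _ (proj2 (eP i)).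
have CXs i : C (Xs i).
  rewrite /Xs; case: (fopp (X (e i))) (Xe0 i) => // a _; apply: circuitsZ.
  by have [] := YP _ (proj2 (eP i)).
have eXs i : e i \in supp (Xs i).
  by rewrite sXs in_supp; have [_ _ ->] := YP _ (proj2 (eP i)).
have eXs' i l : i != l -> e i \notin supp (Xs l).
  move=> il; apply/negP => /(subsetP (XsB l));
    rewrite in_setU1 (negPf (proj2 (eP i))) orbF.
  by rewrite (inj_eq e_inj) (negPf il).
have f0Xs i : f0 \notin supp (Xs i).
  apply/negP => /(subsetP (XsB i));
    rewrite in_setU1 (negPf f0B) orbF => /eqP f0e.
  by rewrite f0e efs in f0fs.
have inC : {in X :: [seq Xs i | i : 'I_k], forall Z, C Z}.
  by move=> Z; rewrite in_cons => /predU1P[->//|/mapP[i _ ->]].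
have UE : \bigcup_(Z <- X :: [seq Xs i | i : 'I_k]) supp Z =
  supp X :|: \bigcup_i supp (Xs i).
  by rewrite big_cons big_map big_enum.
have nX : ~~ (supp X \subset \bigcup_i supp (Xs i)).
  by apply/subsetPn; exists f0 => //; apply/bigcupP => -[i _]; apply/negP.
have [|i|i|Z [CZ Ze Zh]] := @circuits_elim _ _ M k X Xs e _ nX.
- split=> //.
  + rewrite /= map_inj_uniq ?enum_uniq ?andbT.
      by apply/mapP => -[i _ XXs]; have := f0Xs i; rewrite -XXs f0X.
    move=> i l il; apply/eqP; apply: contraT => /eXs'; rewrite -il.
    by rewrite eXs.
  + move=> Z /inC CZ; apply: circuit_atom (supports_supp CZ).
      exact: circuit_supp_neq0.
    exact: circuit_supp_anti.
  (* The upper bound counts the union of the supports outside [B], namely the [k + 1] points of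
     [f0 :: fs]; the lower bound is the triangular list with witnesses [f0] and the [e i]. *)
  rewrite UE /= size_map size_enum_ord; apply/eqP; rewrite eqn_leq;
    apply/andP; split.
    apply: leq_trans (height_indep circuit_supp_neq0 circuit_supp_anti
      circuit_supp_elim _ Bi) _.
    rewrite -[k.+1]/(size (f0 :: fs)) -fsE -cardE; apply: subset_leq_card.
    apply/subsetP => x /setDP[/setUP[xX|/bigcupP[i _ /(subsetP (XsB
      i))/setU1P[->|xB]]]] xB'.
    + by rewrite in_setD xX xB'.
    + by rewrite in_setD; have [-> ->] := eP i.
    + by rewrite xB in xB'.
  pose s := supp X :: [seq supp (Xs i) | i <- enum 'I_k] ++ [::].
  have -> : k.+1 = size s by rewrite /= size_cat size_map size_enum_ord addn0.
  apply: height_ge; [exact: unions0|exact: unionsU| | |].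
  + move=> A; rewrite /s cats0 in_cons => /predU1P[->|/mapP[i _ ->]];
    exact/unions1/supports_supp.
  + rewrite /s; apply/andP; split; first by rewrite cats0 bigcup_image_ord.
    apply: (@triangular_cat _ _ (fun i => supp (Xs i)) e) => //.
      exact: enum_uniq.
    by move=> i; rewrite big_nil in_set0.
  + by rewrite /s cats0 big_cons bigcup_image_ord.
- apply/setDP; split; first by rewrite in_setI eXs (proj1 (eP i)).
  by apply/bigcupP => -[l li]; apply/negP; apply: eXs'; rewrite eq_sym.
- have [_ _ Yee] := YP _ (proj2 (eP i)).
  by rewrite ffunE Yee fmulC fmul1 foppK.
have [CY0 Y0B Y0f] := YP f0 f0B.
have ZB : supp Z \subset f0 |: B.
  apply/subsetP => x; apply: contraLR;
    rewrite in_setU1 negb_or => /andP[xf0 xB].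
  rewrite in_supp negbK; apply/eqP.
  have [/(nthP f0)[i ik <-]|xfs] := boolP (x \in fs).
    by have := Ze (Ordinal ik); rewrite /e (tnth_nth f0).
  apply: hypersum0 (Zh x) => b; rewrite in_cons => /predU1P[->|].
    apply: supp0P; apply: contra xfs => xX.
    have : x \in f0 :: fs by rewrite -fsE mem_enum in_setD xX xB.
    by rewrite in_cons (negPf xf0).
  move=> /mapP[_ /mapP[i _ ->] ->]; apply: supp0P; apply: contra xfs.
  by move=> /(subsetP (XsB i)); rewrite in_setU1 (negPf xB) orbF => /eqP->.
have [a Za] := basis_circuit_uniq Bi CY0 Y0B CZ ZB.
have Zf0 : Z f0 = X f0.
  have := Zh f0; rewrite /hypersum /= -[_ :: X f0 :: _]/([:: fopp (Z f0);
    X f0] ++ _) fsum_cat0.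
    by move/null2/(can_inj (@foppK T)).
  by move=> _ /mapP[_ /mapP[i _ ->] ->]; apply: supp0P.
have Zj : Z j = fmul (X f0) (Y f0 j).
  by rewrite -Zf0 Za !ffunE Y0f -fmulA fmul1.
(* The inner product of [X] and [S] agrees term by term with the hypersum at [j]: the terms at [j],
   [f0] and [e i] are [X j], [- Z j] and [Xs i j]. *)
rewrite /orthogonal (@inner_on _ c _ _ _ (j :: f0 :: fs)); last 2 first.
- have notin f : f \in f0 :: fs -> j != f.
    by move=> /fsP[_]; apply: contraNneq => <-.
  rewrite cons_uniq -fsE enum_uniq andbT fsE; apply/negP => /notin.
  by rewrite eqxx.
- apply/subsetP => x /setIP[xX xS];
    rewrite in_cons -fsE mem_enum in_setD xX andbT.
  have [xB|_] /= := boolP (x \in B); rewrite ?orbT // orbF.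
  by apply: contraTT xS => xj; rewrite in_supp negbK SB.
have := Zh j; rewrite /hypersum /=.
have -> : fsum [:: fopp (Z j),
  X j & [seq V j | V : vec T E <- [seq Xs i | i : 'I_k]]] =
   fsum [:: X j, fopp (Z j) & [seq V j | V : vec T E <- [seq Xs i | i : 'I_k]]].
  exact: perm_fsum (permEl (perm_catCA [:: _] [:: _] _)).
congr (nullset (fsum _)); congr [:: _, _ & _].
- by rewrite Sj fconj1 fmulC fmul1.
- by rewrite SY // fopp_fmulr Zj.
have -> : fs = [seq e i | i <- enum 'I_k] by rewrite (map_tnth_enum (in_tuple
  fs)).
rewrite /image_mem -!map_comp; apply: eq_map => i /=.
by rewrite ffunE SY ?fopp_fmull ?fopp_fmulr //; have [] := eP i.
Qed.

Lemma basis_covector B j : basis B -> j \in B ->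
  exists S, perp c C S /\ supp S :&: B = [set j].
Proof.
move=> bB jB; have [Y YP] : exists Y : E -> vec T E, forall e, e \notin B ->
    [/\ C (Y e), supp (Y e) \subset e |: B & Y e e = Some 1%g].
  suff /choice[Y YP] : forall e, exists Y : vec T E, e \notin B ->
    [/\ C Y, supp Y \subset e |: B & Y e = Some 1%g] by exists Y.
  move=> e; have [eB|eB] := boolP (e \in B); first by exists vzero.
  have [Y [CY YB]] := basis_circuit bB eB.
  case Ye : (Y e) => [y|] // _; exists (vscale (Some y^-1%g) Y) => _; split.
  - exact: circuitsZ.
  - by rewrite supp_vscale.
  - by rewrite ffunE Ye /= mulVg.
(* Given 1 at [j] and 0 on the rest of [B], orthogonality to [Y e] forces the value at [e]. *)
pose S : vec T E := [ffun e => if e == j then Some 1%g else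
  if e \in B then None else fconj c (fopp (Y e j))].
exists S; split; last first.
  apply/setP => e; rewrite in_setI in_supp ffunE in_set1.
  by case: (eqVneq e j) => [->|_]; [rewrite jB|case: (e \in B); rewrite ?andbF].
move=> X CX; apply: orth_sym.
apply: (basis_circuit_orth (basis_indep bB) jB YP) => // [|e eB ej|e eB].
- by rewrite ffunE eqxx.
- by rewrite ffunE (negPf ej) eB.
have ej : e != j by apply: contraNneq eB => ->.
by rewrite ffunE (negPf ej) (negPf eB) fconjK.
Qed.

Lemma basis_circuit_meets B X e : basis B -> perp c C X -> e \notin B ->
  e \in supp X ->
  [disjoint supp X & B] -> False.
Proof.
move=> bB CX eB eX XB; have [Y [CY YB Ye]] := basis_circuit bB eB.
apply: (@orth1 _ c _ X Y e) (CX Y CY) => //; first by rewrite in_supp.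
apply/subsetP => x /setIP[xX /(subsetP YB)/setU1P[->|]]; first exact: set11.
by rewrite (disjointFr XB).
Qed.

Lemma covectors_vector_set : vector_set (covectors c M).
Proof.
apply: (@perp_vector_set _ c _ [set` basis]%classic).
- exact: basis_circuit.
- exact: basis_covector.
- move=> Y CY; have [e eY] : exists e, e \in supp Y.
    apply/set0Pn; apply: contraNneq circuit_supp_neq0 => <-;
      exact: supports_supp.
  have [B bB YB] := basis_extend (circuit_diff circuit_supp_anti (supports_supp
    CY) eY).
  have YeB : supp Y \subset e |: B by rewrite -(setD1K eY) setUS.
  exists B, e; split=> //; last by rewrite -in_supp.
  apply/negP => eB; have /negP[] :=
    indepP _ _ (basis_indep bB) _ (supports_supp CY).
  by apply: subset_trans YeB _; rewrite subUset sub1set eB subxx.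
(* A support basis is independent, hence inside a basis: a circuit within it would meet an echelon
   vector [S j] in [j] alone. *)
move=> B sB; have [|/indepPn[A /supportsP[Y CY <-] YB]] := boolP (indepM B).
  by move=> /basis_extend[B' bB' BB']; exists B' => //; rewrite BB'.
have [j jY] : exists e, e \in supp Y.
  apply/set0Pn; apply: contraNneq circuit_supp_neq0 => <-; exact: supports_supp.
have jB := subsetP YB j jY; have [S WS] := support_basis_rref sB.
have [CS SB] := WS j jB; exfalso.
apply: (@orth1 _ c _ (S j) Y j) (CS Y CY) => //; last by rewrite -SB setIS.
by rewrite in_supp (echelon_neq0 (rref_echelon WS)).
Qed.

(** * Cocircuits and vectors of a strong matroid *)

Local Notation D := (cocircuits c M).

Lemma circuits_vectors X : C X -> perp c D X.
Proof. by move=> CX Y [[CY _] _]; apply: orth_sym; apply: CY. Qed.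

(** A minimal covector inside the support of [basis_covector] still contains [j]; otherwise it would
    be disjoint from [B] and meet a fundamental circuit in a single point. *)
Lemma basis_cocircuit B j : basis B -> j \in B ->
  exists Z, [/\ D Z, supp Z \subset j |: ~: B & Z j != None].
Proof.
move=> bB jB; have [S [CS SB]] := basis_covector bB jB.
have Sj : j \in supp S by move/setP/(_ j): SB; rewrite in_setI jB andbT set11.
have S0 : S <> vzero by move=> S0; rewrite S0 supp_vzero in_set0 in Sj.
have [Z DZ ZS] := minsupp_exists (C :=
  (perp c C `\ vzero)%classic) (conj CS S0).
have ZB x : x \in supp Z -> x \in B -> x = j.
  by move=> /(subsetP ZS) xS xB; apply/set1P; rewrite -SB in_setI xS.
have [[CZ Z0] _] := DZ; exists Z; split=> //.
  apply/subsetP => x xZ; rewrite in_setU1 in_setC.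
  by have [xB|_] := boolP (x \in B); rewrite ?orbT // (ZB x xZ xB) eqxx.
rewrite -in_supp; apply/negP => /negP jZ.
have /supp_neq0/set0Pn[x xZ] := Z0.
have xB : x \notin B by apply: contraNN jZ => /(ZB x xZ) <-.
apply: (basis_circuit_meets bB CZ xB xZ); rewrite disjoint_subset.
by apply/subsetP => y yZ; rewrite inE; apply: contraNN jZ => /(ZB y yZ) <-.
Qed.

(** Take [I] maximal independent off [supp Z] and a basis [B] containing [j |: I]. The covector of
    [B] at [j] turns out to be supported in [supp Z], so minimality makes the supports equal. *)
Lemma cocircuit_basis Z : D Z -> exists B j,
  [/\ basis B, j \in B, supp Z \subset j |: ~: B & Z j != None].
Proof.
move=> [[CZ Z0] minZ]; have [j jZ] := set0Pn _ (proj1 (supp_neq0 _) Z0).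
have [I /maxsetP[/andP[Ii IZ] maxI] _] : {I : {set E} |
    maxset (fun I => indepM I && (I \subset ~: supp Z)) I & set0 \subset I}.
  by apply: maxset_exists; rewrite sub0set (indep0 circuit_supp_neq0).
have circI e Y X : C Y -> supp Y \subset e |: I -> perp c C X -> e \in supp Y ->
    e \in supp X -> [disjoint supp X & I] -> False.
  move=> CY YI CX eY eX XI; apply: (@orth1 _ c _ X Y e) (CX Y CY) => //.
  apply/subsetP => x /setIP[xX /(subsetP YI)/setU1P[->|]]; first exact: set11.
  by rewrite (disjointFr XI).
(* A circuit through [j] inside [j |: I] would meet [Z] in [j] alone. *)
have jI : indepM (j |: I).
  apply: contraT => /(dependent_circuit Ii)[Y [CY YI jY]]; exfalso.
  by apply: (circI j Y Z) => //; rewrite disjoint_sym disjoints_subset.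
have [B bB jIB] := basis_extend jI.
have jB : j \in B by apply: (subsetP jIB); rewrite setU11.
have IB : I \subset B by apply: subset_trans jIB; apply: subsetUr.
have [S [CS SB]] := basis_covector bB jB.
have SjB x : x \in supp S -> x \in B -> x = j.
  by move=> xS xB; apply/set1P; rewrite -SB in_setI xS.
have Sj : j \in supp S by move/setP/(_ j): SB; rewrite in_setI jB andbT set11.
have S0 : S <> vzero by move=> S0; rewrite S0 supp_vzero in_set0 in Sj.
have SI : [disjoint supp S & I].
  rewrite disjoint_subset; apply/subsetP => x xS; rewrite inE; apply/negP => xI.
  have xj := SjB x xS (subsetP IB x xI).
  by have := subsetP IZ x xI; rewrite in_setC xj jZ.
have SZ : supp S \subset supp Z.
  apply/subsetP => e eS; apply: contraT => eZ; exfalso.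
  (* By maximality of [I], a point [e] of [supp S] outside [supp Z] closes a circuit with [I], which
     meets [S] in [e] alone. *)
  have eI : ~~ indepM (e |: I).
    apply/negP => eIi; have := maxI (e |: I);
      rewrite eIi subUset sub1set in_setC eZ IZ.
    move=> /(_ isT (subsetUr _ _)) eIE; move/negP: eZ; apply.
    have : e \in I by rewrite -eIE setU11.
    by rewrite (disjointFr SI eS).
  by have [Y [CY YI eY]] := dependent_circuit Ii eI; apply: (circI e Y S).
have SZE : supp S = supp Z.
  by apply/eqP; rewrite eqEproper SZ; apply: minZ.
exists B, j; split=> //; last by rewrite -in_supp.
rewrite -SZE; apply/subsetP => x xS; rewrite in_setU1 in_setC.
by have [xB|_] := boolP (x \in B); rewrite ?orbT // (SjB x xS xB) eqxx.
Qed.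

Lemma vectors_vector_set : vector_set (vectors c M).
Proof.
apply: (@perp_vector_set _ c _ [set B | basis (~: B)]%classic).
- move=> B j bB jB; rewrite -[B]setCK; apply: basis_cocircuit => //.
  by rewrite in_setC.
- move=> B e bB eB; have [|Y [CY YB Ye]] := @basis_circuit _ e bB.
    by rewrite in_setC negbK.
  exists Y; split; first exact: circuits_vectors.
  apply/setP => x; rewrite in_setI in_set1; apply/andP/eqP => [[xY xB]|->].
    by have := subsetP YB x xY; rewrite in_setU1 in_setC xB orbF => /eqP.
  by rewrite in_supp.
- move=> Z /cocircuit_basis[B [j [bB jB ZB Zj]]]; exists (~: B), j; split=> //.
    by rewrite /= setCK.
  by rewrite in_setC jB.
(* Circuits are vectors, so a support basis meets each of them and its complement contains none. *)
move=> B sB; have Bi : indepM (~: B).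
  apply: contraT => /indepPn[A /supportsP[Y CY <-] YB]; exfalso.
  have Y0 : Y <> vzero by move=> Y0; apply: (@circuits_neq0 _ _ M); rewrite -Y0.
  have := support_basis_hits sB (circuits_vectors CY) Y0.
  by rewrite setI_eq0 disjoint_sym disjoints_subset YB.
have [B' bB' BB'] := basis_extend Bi; exists (~: B'); first by rewrite /= setCK.
by apply/orP; right; rewrite -[B]setCK setCS.
Qed.

End StrongMatroid.

Local Open Scope classical_set_scope.

Theorem theorem2p18 (T : tract) (c : conjugation T) (E : finType)
    (E_nonempty : (0 < #|E|)%N) :
  (forall M : strong_matroid T E,
      vector_set (vectors c M) /\ vector_set (covectors c M)) /\
  (forall W : set (vec T E), vector_set W ->
     exists M : strong_matroid T E,
       [/\ W = covectors c M,
           cocircuits c M = minsupp (covectors c M `\ vzero) &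
           circuits M = minsupp (perp c (covectors c M) `\ vzero)]).
Proof.
split=> [M|W W_vs]; last exact: vector_set_matroid.
by split; [exact: vectors_vector_set|exact: covectors_vector_set].
Qed.
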